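(* Let $S\subset\mathbb Z^n$ be a nonempty finite set and let $H$ be a finite-dimensional complex Hilbert space with orthonormal basis $(e_m)_{m\in S}$ on which the torus $(\mathbb C^* )^n$ acts linearly by $U_ae_m=a^me_m$. Let $F^1\supseteq F^2\supseteq\dots\supseteq F^N$ be a decreasing chain of subspaces of $H$. For a nonzero subspace $F\subseteq H$ let $P(F)\subset\mathbb R^n$ be its weight polytope, and call $v\in\mathbb R^n$ admissible for the chain if, for every $j$ with $F^j\ne0$, the linear functional $\langle v,\cdot\rangle$ has a unique maximizer on $P(F^j)$. Then: (a) The weight polytope $P(F)$ is well defined, and the inadmissible $v$ lie in a finite union of proper linear hyperplanes, namely the perpendiculars of the nonzero differences of vertices of the finitely many weight polytopes $P(F^j)$. (b) Fix an admissible $v$ and put $D_t=U_{(e^{tv_1},\dots,e^{tv_n})}$. Then, for each $j$, there is a subset $I_j\subset S$ with $\#I_j=\dim F^j$ such that $D_tF^j$ converges in the Grassmannian to $\operatorname{span}\{e_m:m\in I_j\}$ as $t\to\infty$, and the orthogonal projections $P_t^j$ onto $D_tF^j$ converge in operator norm to the coordinate projections (the orthogonal projections onto $\operatorname{span}\{e_m:m\in I_j\}$); the limit index sets are nested, $I_1\supseteq I_2\supseteq\dots\supseteq I_N$. Consequently $Q_t=\sum_{j=1}^NP_t^j$ converges in operator norm to the diagonal operator $Q_\infty$ with $Q_\infty e_m=q_me_m$, where $q_m=\#\{j:m\in I_j\}\in\{0,1,\dots,N\}$ and \[ \sum_{m\in S}q_m=\sum_{j=1}^N\dim F^j. \] (c)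 Moreover, if the elements of $H$ are functions on $(\mathbb C^* )^n$ with $e_m(z)=c_mz^m$, $c_m\ne0$, and $F^j=F_1^j$ is the subspace of functions in $H$ vanishing to order at least $j$ at $1=(1,\dots,1)$, then for $p_t=(e^{-tv_1},\dots,e^{-tv_n})$ one has $F^j_{p_t}=D_tF^j_1$, so the orthogonal projection onto $F^j_{p_t}$ is $P_t^j$.
   Context: For $a\in(\mathbb C^* )^n$ and $m\in\mathbb Z^n$, $a^m=\prod_ia_i^{m_i}$. Weight polytope: for a nonzero subspace $F\subseteq H$ of dimension $r$, choose a nonzero $\xi_F\in\bigwedge^rF$ and expand $\xi_F=\sum_{\#I=r}c_Ie_I$ in the exterior basis $e_I=\bigwedge_{m\in I}e_m$, $I\subset S$, formed with respect to a fixed total order on $S$; then \[ P(F)=\operatorname{conv}\Bigl\{\sum_{m\in I}m:\ c_I\ne0\Bigr\}\subset\mathbb R^n. \] Well-definedness means independence of the choice of $\xi_F$ (and of the order on $S$). In (c), for $p\in(\mathbb C^* )^n$, $F_p^j$ denotes the subspace of functions in $H$ vanishing to order at least $j$ at $p$, the zero function having vanishing order $+\infty$. *)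

(* Defs.v *)
From HB Require Import structures.
From mathcomp Require Import all_boot all_order all_algebra finmap complex.
From mathcomp Require Import sesquilinear.
From mathcomp Require Import all_classical all_reals all_analysis.

Set Implicit Arguments.
Unset Strict Implicit.
Unset Printing Implicit Defensive.

Import Order.TTheory GRing.Theory Num.Theory.
Import numFieldNormedType.Exports.

Local Open Scope classical_set_scope.
Local Open Scope ring_scope.
Local Open Scope complex_scope.

Section Torus.

Definition torus (K : fieldType) (n : nat) (a : 'rV[K]_n) : Prop :=
  forall i, a 0 i != 0.

Definition monomial (K : fieldType) (n : nat) (a : 'rV[K]_n)
    (m : 'rV[int]_n) : K :=
  \prod_i a 0 i ^ m 0 i.

Definition expv (R : realType) (n : nat) (w : 'rV[R]_n) : 'rV[R[i]]_n :=
  \row_i (expR (w 0 i))%:C.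

End Torus.

Section Convexity.
Variables (R : realType) (n : nat).
Implicit Types (P : set 'rV[R]_n) (v x y z : 'rV[R]_n).

Definition pairing v x : R := \sum_i v 0 i * x 0 i.

Definition convex_hull (A : set 'rV[R]_n) : set 'rV[R]_n :=
  smallest (@convex_set R 'rV[R]_n) A.

(* Vertices of a polytope, as its extreme points. *)
Definition vertex P x : Prop :=
  P x /\ forall y z (s : R), P y -> P z -> 0 < s < 1 ->
    x = s *: y + (1 - s) *: z -> y = x /\ z = x.

Definition unique_maximizer v P : Prop :=
  exists! x, P x /\ forall y, P y -> pairing v y <= pairing v x.

Definition perp (d : 'rV[R]_n) : set 'rV[R]_n := [set v | pairing v d = 0].

Definition linear_hyperplane (A : set 'rV[R]_n) : Prop :=
  exists2 W : {vspace 'rV[R]_n}, (\dim W).+1 = n & A = [set` W].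

End Convexity.

Section ExteriorPower.
Variables (K : fieldType) (H : vectType K).

(* The r-th exterior power of H is realised inside the functions of r linear
   forms on H, by the canonical embedding (injective since H is
   finite-dimensional)
     (u_1 /\ ... /\ u_r) (phi_1, ..., phi_r) = det (phi_i (u_k)). *)
Definition multiform (r : nat) : lmodType K := ('I_r -> 'Hom(H, K^o)) -> K^o.

Definition wedge (r : nat) (u : 'I_r -> H) : multiform r :=
  fun phi => \det (\matrix_(i, k) (phi i (u k) : K)).

(* The r-th exterior power of the subspace F, inside that of H. *)
Definition exterior_power (r : nat) (F : {vspace H}) : set (multiform r) :=
  [set xi | exists (k : nat) (a : 'I_k -> K) (u : 'I_k -> 'I_r -> H),
      (forall l i, u l i \in F) /\ xi = \sum_(l < k) a l *: wedge (u l)].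

Variables (S : finType) (e : S -> H).

Definition total_order (le : rel S) : Prop :=
  [/\ total le, antisymmetric le & transitive le].

(* e_I = e_{m_1} /\ ... /\ e_{m_r} where I = {m_1 < ... < m_r}; only
   meaningful when #|I| = r. *)
Definition exterior_basis (le : rel S) (r : nat) (I : {set S}) : multiform r :=
  wedge (fun i : 'I_r => [seq e m | m <- sort le (enum I)]`_i).

Definition exterior_expansion (le : rel S) (r : nat) (xi : multiform r)
    (c : {set S} -> K) : Prop :=
  (forall I : {set S}, #|I| != r -> c I = 0) /\
  xi = \sum_(I : {set S} | #|I| == r) c I *: exterior_basis le I.

End ExteriorPower.

Section WeightPolytope.
Variables (R : realType) (n : nat) (S : {fset 'rV[int]_n}).
Variables (H : vectType R[i]) (e : S -> H).

Definition weight_sum (I : {set S}) : 'rV[R]_n :=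
  \sum_(m in I) map_mx intr (val m).

Definition weight_hull (c : {set S} -> R[i]) : set 'rV[R]_n :=
  convex_hull [set weight_sum I | I in [set I | c I != 0]].

Definition is_weight_polytope (F : {vspace H}) (P : set 'rV[R]_n) : Prop :=
  exists (le : rel S) (xi : multiform H (\dim F)) (c : {set S} -> R[i]),
    [/\ total_order le, exterior_power F xi, xi <> 0,
        exterior_expansion e le xi c & P = weight_hull c].

(* P(F), computed from one choice of the order and of xi_F. *)
Definition weight_polytope (F : {vspace H}) : set 'rV[R]_n :=
  xget set0 [set P | is_weight_polytope F P].

Definition admissible (N : nat) (F : 'I_N -> {vspace H}) (v : 'rV[R]_n) :
    Prop :=
  forall j, F j != 0%VS -> unique_maximizer v (weight_polytope (F j)).

Definition vertex_differences (N : nat) (F : 'I_N -> {vspace H}) :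
    set 'rV[R]_n :=
  [set d | d != 0 /\ exists j x y,
    [/\ F j != 0%VS, vertex (weight_polytope (F j)) x,
        vertex (weight_polytope (F j)) y & d = x - y]].

End WeightPolytope.

Section Hilbert.
Variables (R : realType) (H : vectType R[i]).
Variable dot : {dot H for @Num.conj R[i]}.

Definition hnorm (x : H) : R := Num.sqrt (complex.Re (dot x x)).

Definition opnorm (A : 'End(H)) : R :=
  sup [set hnorm (A x) | x in [set x | hnorm x <= 1]].

Definition opnorm_cvg (A : R -> 'End(H)) (B : 'End(H)) : Prop :=
  opnorm (A t - B) @[t --> +oo] --> (0 : R).

Definition orthproj (V : {vspace H}) : 'End(H) := daddv_pi V (orthov dot V).

(* The topology of the Grassmannian of r-dimensional subspaces is the quotient
   topology along (u_1, ..., u_r) |-> span (u_1, ..., u_r), defined on the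
   linearly independent r-tuples of H. *)
Definition grassmann_open (r : nat) (O : set {vspace H}) : Prop :=
  forall u : r.-tuple H, free u -> O <<u>>%VS ->
    exists2 eps : R, 0 < eps &
      forall w : r.-tuple H, free w ->
        (forall i, hnorm (tnth w i - tnth u i) < eps) -> O <<w>>%VS.

Definition grassmann_cvg (r : nat) (V : R -> {vspace H}) (W : {vspace H}) :
    Prop :=
  [/\ forall t, \dim (V t) = r, \dim W = r &
      forall O, grassmann_open r O -> O W -> \forall t \near +oo, O (V t)].

End Hilbert.

Section Vanishing.
Variables (K : numFieldType) (n : nat).

(* Iterated partial derivatives along the coordinates listed in s. *)
Definition partials (s : seq 'I_n) (f : 'rV[K]_n -> K^o) : 'rV[K]_n -> K^o :=
  foldr (fun i g => fun z => 'D_(delta_mx 0 i) g z) f s.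

Definition vanishes_to_order (j : nat) (f : 'rV[K]_n -> K^o) (p : 'rV[K]_n) :
    Prop :=
  forall s : seq 'I_n, (size s < j)%N -> partials s f p = 0.

(* The elements of H are functions on the torus; [ev f] is the function f,
   extended arbitrarily off the torus. *)
Definition function_space (H : vectType K) (ev : H -> 'rV[K]_n -> K) : Prop :=
  (forall (a : K) (f g : H) z, torus z ->
     ev (a *: f + g) z = a * ev f z + ev g z) /\
  (forall f g : H, (forall z, torus z -> ev f z = ev g z) -> f = g).

Definition vanishing_set (H : vectType K) (ev : H -> 'rV[K]_n -> K) (j : nat)
    (p : 'rV[K]_n) : set H :=
  [set f | vanishes_to_order j (ev f) p].

End Vanishing.

(* Main.v *)
Require Import Defs.
From HB Require Import structures.
From mathcomp Require Import all_boot all_order all_algebra finmap complex.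
From mathcomp Require Import perm sesquilinear.
From mathcomp Require Import all_classical all_reals all_analysis.
From mathcomp Require Import ring lra.

(** The weight polytope is a shadow of a matroid.  Call a set of weights I a
    coordinate basis of a subspace F when it has dim F elements and no nonzero
    vector of F has all its I-coordinates equal to 0.  The top exterior power
    of F is a line, spanned by the wedge of any basis of F, and its
    e_I-coefficient is, up to sign, the minor of that basis on the coordinates
    I; so it is nonzero exactly when I is a coordinate basis of F
    ([coordinate_basis_coef]).  This description mentions neither the order on
    the weights nor the multivector, hence P(F) is well defined
    ([weight_polytopeE]).

    If v has several maximizers on a polytope P, then two distinct vertices of P
    lie on the maximal face: among the generators on that face, take one
    farthest from a given point, then one farthest from the first
    ([vertices_of_face]).  So v is perpendicular to a nonzero difference of
    vertices, and there are finitely many of these because vertices are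
    generators.

    For admissible v, take a coordinate basis I of F of maximal weight, and the
    reduced echelon frame f_i = e_i + sum_(m notin I) a_im e_m of F.  Whenever
    a_im <> 0, exchanging i for m gives another coordinate basis, whose weight
    is at most that of I; equality would make its weight sum a second maximizer
    of v on P(F), so <v, m> < <v, i> ([dominant_echelon_exists]).  These strict
    inequalities carry all of part (b).  Rescaling D_t f_i so that its
    i-coordinate is 1 gives a frame of D_t F which differs from e_i by terms of
    size exp (t (<v, m> - <v, i>)); it converges to (e_i) for i in I, which is
    convergence in the Grassmannian ([flow_grassmann_cvg]).  Two subspaces with
    close echelon frames have close orthogonal projections
    ([orthproj_echelon_dist]), which gives the convergence in operator norm.
    The index sets are nested because a weight i that is leading for a smaller
    subspace but not for a larger one would have to be both strictly below and
    strictly above some weight k of the larger index set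
    ([dominant_echelon_nested]).

    For part (c), the functions of H are Laurent polynomials on the torus, and
    an iterated partial derivative multiplies the coefficient of z^m by a
    polynomial in m and shifts all exponents by a common vector.  Vanishing to
    a given order at p is thus a list of linear conditions on the numbers
    (coefficient of z^m) * p^m ([vanishes_laurent]), and the action of D_t on
    the coefficients is exactly compensated by moving p from 1 to p_t
    ([vanishing_set_diag]). *)

Set Implicit Arguments.
Unset Strict Implicit.
Unset Printing Implicit Defensive.

Import Order.TTheory GRing.Theory Num.Theory.
Import numFieldNormedType.Exports.

Local Open Scope classical_set_scope.
Local Open Scope ring_scope.
Local Open Scope complex_scope.

(** * Coordinates and expansions of exterior products *)

Section Coordinates.
Variables (K : fieldType) (H : vectType K) (S : finType) (e : S -> H).

Definition coordform (m : S) : 'Hom(H, K^o) :=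
  linfun (coord (codom_tuple e) (enum_rank m) : H -> K^o).

Lemma coordformZ m a h : coordform m (a *: h) = a * coordform m h.
Proof. exact: linearZ. Qed.

Hypothesis e_basis : basis_of fullv (codom e).

Lemma coordform_basis m k : coordform m (e k) = (k == m)%:R.
Proof.
rewrite lfunE /=.
have -> : e k = (codom_tuple e)`_(enum_rank k).
  by rewrite nth_codom enum_rankK.
rewrite coord_free ?(basis_free e_basis) //.
by rewrite (inj_eq enum_rank_inj).
Qed.

Lemma coordform_expand h : h = \sum_m coordform m h *: e m.
Proof.
have hb : basis_of fullv (codom_tuple e) by [].
rewrite {1}(coord_basis hb (memvf h)).
rewrite (reindex (@enum_rank S)) /=; last first.
  by exists enum_val => i _; rewrite ?enum_rankK ?enum_valK.
by apply: eq_bigr => m _; rewrite nth_codom enum_rankK lfunE.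
Qed.

Lemma coordform_sum (a : S -> K) (A : pred S) m :
  coordform m (\sum_(k | A k) a k *: e k) = (if A m then a m else 0).
Proof.
rewrite linear_sum /=; case: ifP => Am.
  rewrite (bigD1 m) //= coordformZ coordform_basis eqxx mulr1 big1 ?addr0 //.
  by move=> k /andP[_ /negbTE km]; rewrite coordformZ coordform_basis km mulr0.
rewrite big1 // => k Ak; rewrite coordformZ coordform_basis.
by case: eqP => [km|_]; [rewrite km Am in Ak|rewrite mulr0].
Qed.

Lemma coordform_inj h h' : (forall m, coordform m h = coordform m h') -> h = h'.
Proof.
by move=> hh; rewrite (coordform_expand h) (coordform_expand h'); apply: eq_bigr => m _; rewrite hh.
Qed.

(** The bases of the matroid that F defines on the coordinates: I is one of them
    when restriction to I identifies F with the functions on I. *)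
Definition coordinate_basis (F : {vspace H}) (I : {set S}) : Prop :=
  #|I| = \dim F /\
  forall f, f \in F -> (forall m, m \in I -> coordform m f = 0) -> f = 0.

End Coordinates.

Section Expansion.
Variables (K : fieldType) (H : vectType K) (S : finType) (e : S -> H).
Hypothesis e_basis : basis_of fullv (codom e).
Local Notation x_ := (coordform e).

Section Order.
Variables (le : rel S) (r : nat).

Lemma wedge_lincomb (J : finType) (b : J -> H) (a : J -> 'I_r -> K) :
  wedge (fun k : 'I_r => \sum_j a j k *: b j) =
  \sum_(f : {ffun 'I_r -> J}) (\prod_k a (f k) k) *: wedge (b \o f).
Proof.
apply/funext => phi; rewrite fct_sumE /wedge.
rewrite -det_tr {1}/determinant.
transitivity (\sum_(f : {ffun 'I_r -> J}) \sum_(s : 'S_r)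
  (-1) ^+ s * \prod_k (a (f k) k * phi (s k) (b (f k)))).
  rewrite exchange_big; apply: eq_bigr => /= s _; rewrite -big_distrr /=.
  congr (_ * _).
  rewrite -(bigA_distr_bigA (fun k j => a j k * phi (s k) (b j))) /=.
  apply: eq_bigr => k _; rewrite !mxE linear_sum; apply: eq_bigr => j _.
  by rewrite linearZ.
apply: eq_bigr => f _.
transitivity ((\prod_k a (f k) k) * \det (\matrix_(i, k) (phi i (b (f k)) : K)));
  last by [].
rewrite -det_tr [RHS]big_distrr /=.
apply: eq_bigr => s _.
rewrite big_split /= mulrCA; congr (_ * (_ * _)).
by apply: eq_bigr => k _; rewrite !mxE.
Qed.

Lemma wedge_perm (u : 'I_r -> H) (s : 'S_r) :
  wedge (u \o s) = (-1) ^+ s *: wedge u.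
Proof.
apply/funext => phi; rewrite fctE /wedge.
transitivity (\det ((\matrix_(i, k) (phi i (u k) : K)) *m perm_mx s^-1)).
  by rewrite -col_permE; congr (\det _); apply/matrixP => i k; rewrite !mxE ?invgK.
by rewrite det_mulmx det_perm odd_permV mulrC.
Qed.

Lemma wedge_repeat (u : 'I_r -> H) : ~ injective u -> wedge u = 0.
Proof.
move=> /injectiveP /injectivePn[i1 [i2 i12 u12]]; apply/funext => phi.
rewrite /wedge -det_tr (determinant_alternate i12) // => j.
by rewrite !mxE u12.
Qed.

Lemma size_sort_enum (I : {set S}) : size (sort le (enum I)) = #|I|.
Proof. by rewrite size_sort cardE. Qed.

Lemma nth_basis_sort (I : {set S}) (m0 : S) (i : 'I_r) : #|I| = r ->
  [seq e m | m <- sort le (enum I)]`_i = e (nth m0 (sort le (enum I)) i).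
Proof. by move=> cI; rewrite (nth_map m0) // size_sort_enum cI. Qed.

(** A repeated index kills the product; otherwise sorting the indices only costs
    the sign of a permutation.  The cardinality clause lets the expansion
    discard the first case. *)
Lemma wedge_basis (f : {ffun 'I_r -> S}) : exists a : K,
  wedge (e \o f) = a *: (exterior_basis e le [set f k | k in 'I_r]%SET : multiform H r)
  /\ (a != 0 -> #|[set f k | k in 'I_r]%SET| = r).
Proof.
case: (pselect (injective f)) => [finj|fninj]; last first.
  exists 0; rewrite scale0r eqxx; split=> //; apply: wedge_repeat => ef; apply: fninj.
  by move=> i j fij; apply: ef => /=; rewrite fij.
set I := [set f k | k in 'I_r]%SET.
have cI : #|I| = r by rewrite card_imset // card_ord.
case: (posnP r) => [r0|r_gt0].
  exists 1; split=> //; rewrite scale1r /exterior_basis; congr wedge.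
  by apply/funext => i; by move: (leq_ltn_trans (leq0n i) (ltn_ord i)) => /gtn_eqF/eqP.
have m0 := f (Ordinal r_gt0).
pose sI := sort le (enum I).
have szI : size sI = r by rewrite size_sort_enum.
have usI : uniq sI by rewrite sort_uniq enum_uniq.
have idx_lt (k : 'I_r) : (index (f k) sI < r)%N.
  by rewrite -[X in (_ < X)%N]szI index_mem mem_sort mem_enum; apply: imset_f.
pose s0 k := Ordinal (idx_lt k).
have s0_inj : injective s0.
  move=> i j [] /(congr1 (nth m0 sI)); rewrite !nth_index; first exact: finj.
    by rewrite mem_sort mem_enum; apply: imset_f.
  by rewrite mem_sort mem_enum; apply: imset_f.
(* s0 sends k to the rank of f k in the sorted list of values of f. *)
exists ((-1) ^+ (perm s0_inj)); split=> //.
rewrite /exterior_basis -wedge_perm; congr wedge; apply/funext => k /=.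
rewrite (nth_basis_sort m0) // permE /= nth_index //.
by rewrite mem_sort mem_enum; apply: imset_f.
Qed.

(** Expand each factor in the basis e, distribute, and collect the index
    functions according to their image. *)
Lemma exterior_basis_expansion (u : 'I_r -> H) : exists c : {set S} -> K,
  exterior_expansion e le (wedge u : multiform H r) c.
Proof.
have [a aP] := choice wedge_basis.
have uE : u = (fun k => \sum_m x_ m (u k) *: e m).
  by apply/funext => k; rewrite -coordform_expand.
pose c (I : {set S}) := if #|I| == r then
  \sum_(f : {ffun 'I_r -> S} | [set f k | k in 'I_r]%SET == I)
     (\prod_k x_ (f k) (u k)) * a f else 0.
exists c; split=> [I /negbTE cI|]; first by rewrite /c cI.
rewrite {1}uE wedge_lincomb.
rewrite (bigID (fun f : {ffun 'I_r -> S} => #|[set f k | k in 'I_r]%SET| == r)) /=.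
rewrite [X in _ + X]big1 => [|f /eqP cf]; last first.
  have [fE f0] := aP f; rewrite fE.
  by have [->|/f0 //] := eqVneq (a f) 0; rewrite scale0r scaler0.
rewrite addr0 (partition_big (fun f : {ffun 'I_r -> S} => [set f k | k in 'I_r]%SET)
   (fun I => #|I| == r)) //=.
apply: eq_bigr => I cI; rewrite /c cI scaler_suml; apply: eq_big => f.
  by case: ([set f k | k in 'I_r]%SET =P I) => [->|]; rewrite ?cI ?andbF.
by move=> /andP[_ /eqP fI]; have [-> _] := aP f; rewrite fI scalerA.
Qed.

(** Evaluation at this family of linear forms reads off the coefficient of e_I
    in a multivector.  The element m0 is only the default value of [nth]. *)
Definition sorted_coordforms (m0 : S) (I : {set S}) (i : 'I_r) : 'Hom(H, K^o) :=
  x_ (nth m0 (sort le (enum I)) i).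

(** The matrix of pairings is the identity when I = J; otherwise some element of
    I lies outside J and its row vanishes. *)
Lemma exterior_basis_dual m0 (I J : {set S}) : #|I| = r -> #|J| = r ->
  (exterior_basis e le J : multiform H r) (sorted_coordforms m0 I) = (I == J)%:R.
Proof.
move=> cI cJ; rewrite /exterior_basis /wedge.
have ent (i k : 'I_r) : x_ (nth m0 (sort le (enum I)) i) ([seq e m | m <- sort le (enum J)]`_k)
   = (nth m0 (sort le (enum J)) k == nth m0 (sort le (enum I)) i)%:R.
  by rewrite (nth_basis_sort m0) // coordform_basis.
have [IJ|IJ] := eqVneq I J.
  rewrite -[RHS](det1 K r); congr (\det _); apply/matrixP => i k.
  rewrite !mxE /sorted_coordforms ent -IJ nth_uniq ?sort_uniq ?enum_uniq ?size_sort_enum ?cI //.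
  by rewrite eq_sym.
have /subsetPn[m mI mJ] : ~~ (I \subset J).
  by apply: contraNN IJ => IJ; rewrite eqEcard IJ cI cJ leqnn.
have mlt : (index m (sort le (enum I)) < r)%N.
  by rewrite -[X in (_ < X)%N]cI -size_sort_enum index_mem mem_sort mem_enum.
rewrite (expand_det_row _ (Ordinal mlt)) big1 // => k _.
rewrite !mxE /sorted_coordforms ent /= nth_index ?mem_sort ?mem_enum //.
case: eqP => [mE|]; rewrite ?mul0r //.
have : nth m0 (sort le (enum J)) k \in J.
  by rewrite -mem_enum -(mem_sort le) mem_nth // size_sort_enum cJ.
by rewrite mE (negbTE mJ).
Qed.

Lemma exterior_coefE m0 (xi : multiform H r) c : exterior_expansion e le xi c ->
  forall I : {set S}, #|I| = r -> c I = xi (sorted_coordforms m0 I).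
Proof.
move=> [_ ->] I cI; rewrite fct_sumE (bigD1 I) /= ?cI // fctE exterior_basis_dual //.
rewrite eqxx big1 ?addr0; first by rewrite [RHS]mulr1.
move=> J /andP[/eqP cJ /negbTE JI]; rewrite fctE exterior_basis_dual //.
by rewrite eq_sym JI [LHS]mulr0.
Qed.

End Order.
End Expansion.

(** * The top exterior power of a subspace and its weight polytope *)

Section TopExteriorPower.
Variables (K : fieldType) (H : vectType K) (F : {vspace H}).
Local Notation r := (\dim F).

Definition volume : multiform H r := wedge (fun k : 'I_r => (vbasis F)`_k).

Lemma volume_exterior : exterior_power F volume.
Proof.
exists 1%N, (fun=> 1), (fun _ k => (vbasis F)`_k); split=> [_ i|].
  by apply: vbasis_mem; rewrite mem_nth // size_tuple.
by rewrite big_ord1 scale1r.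
Qed.

(** The coordinate forms of the basis of F evaluate the product to the
    determinant of the identity. *)
Lemma volume_neq0 : volume <> 0.
Proof.
move=> /(congr1 (fun xi : multiform H r =>
  xi (fun i => linfun (coord (vbasis F) i : H -> K^o)))).
rewrite /volume /wedge (_ : (\matrix_(i, k) _) = 1%:M).
  by rewrite det1 => /eqP; rewrite oner_eq0.
apply/matrixP => i k; rewrite !mxE lfunE /= coord_free 1?eq_sym //.
exact: basis_free (vbasisP F).
Qed.

(** The matrix of any dim F vectors of F factors through the basis of F, so the
    determinant is multiplicative and the top exterior power is a line. *)
Lemma exterior_powerE (xi : multiform H r) :
  exterior_power F xi -> exists a : K, xi = a *: volume.
Proof.
move=> [n [a [u [uF ->]]]].
exists (\sum_(l < n) a l * \det (\matrix_(i, k) coord (vbasis F) i (u l k))).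
rewrite scaler_suml; apply: eq_bigr => l _; rewrite -scalerA; congr (_ *: _).
apply/funext => phi.
transitivity (\det (\matrix_(i, k) coord (vbasis F) i (u l k)) *
  \det (\matrix_(i, k) (phi i (vbasis F)`_k : K))); last by [].
rewrite mulrC -det_mulmx; congr (\det _); apply/matrixP => i k; rewrite !mxE.
rewrite [u l k in LHS](coord_vbasis (uF l k)) linear_sum; apply: eq_bigr => j _.
by rewrite linearZ !mxE [LHS]mulrC.
Qed.

Variables (S : finType) (e : S -> H).
Hypothesis e_basis : basis_of fullv (codom e).
Local Notation x_ := (coordform e).

(** This coefficient is the minor of the basis of F on the coordinates I; a
    vector in the kernel of the minor is the list of coefficients of a vector of
    F that vanishes on I. *)
Lemma volume_coef_neq0 (le : rel S) (m0 : S) (I : {set S}) : #|I| = r ->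
  volume (sorted_coordforms e le m0 I) != 0 <-> coordinate_basis e F I.
Proof.
move=> cI; rewrite /volume /wedge.
set M := (X in \det X).
have Mmul (y : 'rV[K]_r) : y *m M^T =
    \row_i x_ (nth m0 (sort le (enum I)) i) (\sum_k y 0 k *: (vbasis F)`_k).
  apply/rowP => i; rewrite !mxE linear_sum; apply: eq_bigr => k _.
  by rewrite !mxE linearZ.
split.
- move=> detM; split=> // f fF f0; apply/eqP; apply: contraNT detM => fn0.
  rewrite -det_tr; apply/det0P; exists (\row_k coord (vbasis F) k f).
    apply: contraNneq fn0 => /rowP c0; rewrite (coord_vbasis fF) big1 // => k _.
    by have := c0 k; rewrite !mxE => ->; rewrite scale0r.
  rewrite Mmul; apply/rowP => i; rewrite !mxE.
  under eq_bigr do rewrite mxE.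
  rewrite -(coord_vbasis fF) f0 //.
  by rewrite -mem_enum -(mem_sort le) mem_nth // size_sort_enum cI.
- move=> [_ inj]; rewrite -det_tr; apply/negP => /det0P[y yn0 yM].
  move/negP: yn0; apply.
  have y0 : \sum_k y 0 k *: (vbasis F)`_k = 0.
    apply: inj.
      apply: memv_suml => k _.
      by rewrite memvZ // vbasis_mem // mem_nth // size_tuple.
    move=> m mI; have mlt : (index m (sort le (enum I)) < r)%N.
      by rewrite -[X in (_ < X)%N]cI -(size_sort_enum le) index_mem mem_sort mem_enum.
    have := Mmul y; rewrite yM => /rowP /(_ (Ordinal mlt)); rewrite !mxE /= => ->.
    by rewrite nth_index // mem_sort mem_enum.
  apply/eqP/rowP => k; rewrite mxE.
  by have /freeP := basis_free (vbasisP F); apply.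
Qed.

(** The condition on the right knows nothing of the order or of the multivector:
    this is what makes the weight polytope well defined. *)
Lemma coordinate_basis_coef (le : rel S) (m0 : S) (xi : multiform H r) c :
  exterior_power F xi -> xi <> 0 -> exterior_expansion e le xi c ->
  forall I, c I != 0 <-> coordinate_basis e F I.
Proof.
move=> /exterior_powerE[a ->] an0 exp I.
have {}an0 : a != 0 by apply/eqP => a0; apply: an0; rewrite a0 scale0r.
have [cI|cI] := eqVneq #|I| r; last first.
  rewrite (exp.1 _ cI) eqxx; split=> // -[cI']; by rewrite cI' eqxx in cI.
rewrite (exterior_coefE e_basis m0 exp cI) -(volume_coef_neq0 le m0 cI).
by rewrite [X in X != 0](_ : _ = a * volume (sorted_coordforms e le m0 I)) // mulf_eq0 negb_or an0.
Qed.

Lemma exterior_expansion_exists (le : rel S) (xi : multiform H r) :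
  exterior_power F xi -> exists c, exterior_expansion e le xi c.
Proof.
move=> /exterior_powerE[a ->].
have [c [c0 cE]] := exterior_basis_expansion e_basis le (fun k : 'I_r => (vbasis F)`_k).
exists (fun I => a * c I); split=> [I /c0 ->|]; first by rewrite mulr0.
by rewrite /volume cE scaler_sumr; apply: eq_bigr => I _; rewrite scalerA.
Qed.

Lemma exterior_expansion_unique (le : rel S) (m0 : S) (xi : multiform H r) c c' :
  exterior_expansion e le xi c -> exterior_expansion e le xi c' -> c = c'.
Proof.
move=> cE c'E; apply/funext => I.
have [cI|cI] := eqVneq #|I| r; last by rewrite cE.1 ?c'E.1.
by rewrite (exterior_coefE e_basis m0 cE) // (exterior_coefE e_basis m0 c'E).
Qed.

End TopExteriorPower.
Arguments volume {K H} F _.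

Section WeightPolytopeE.
Variables (R : realType) (n : nat) (S : {fset 'rV[int]_n}).
Variables (H : vectType R[i]) (e : S -> H).
Hypothesis e_basis : basis_of fullv (codom e).
Hypothesis S_neq0 : S != fset0.

Lemma total_order_exists : exists le : rel S, total_order le.
Proof.
exists (fun x y => (enum_rank x <= enum_rank y)%N); split.
- by move=> x y; exact: leq_total.
- by move=> x y xy; apply/enum_rank_inj/val_inj/anti_leq.
- by move=> x y z; exact: leq_trans.
Qed.

Lemma is_weight_polytopeE (F : {vspace H}) P : is_weight_polytope e F P <->
  P = convex_hull [set @weight_sum R n S I | I in coordinate_basis e F].
Proof.
have [m0 m0S] := fset0Pn _ S_neq0.
have hullE le (xi : multiform H (\dim F)) c : exterior_power F xi -> xi <> 0 ->
    exterior_expansion e le xi c -> weight_hull c =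
    convex_hull [set @weight_sum R n S I | I in coordinate_basis e F].
  move=> xiF xin0 cE; congr convex_hull; congr image; apply/seteqP.
  by split=> I /(coordinate_basis_coef e_basis [` m0S]%fset xiF xin0 cE).
split=> [[le [xi [c [_ xiF xin0 cE ->]]]]|->]; first exact: hullE xiF xin0 cE.
have [le le_order] := total_order_exists.
have [c cE] := exterior_expansion_exists e_basis le (volume_exterior F).
exists le, (volume F), c; split=> //; [exact: volume_exterior|exact: volume_neq0|].
by rewrite (hullE _ _ _ (volume_exterior F) (@volume_neq0 _ _ F) cE).
Qed.

Lemma weight_polytopeE (F : {vspace H}) : weight_polytope e F =
  convex_hull [set weight_sum R I | I in coordinate_basis e F].
Proof.
apply/is_weight_polytopeE; rewrite /weight_polytope.
by case: xgetP => // /(_ _ ((is_weight_polytopeE F _).2 erefl)).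
Qed.

Lemma coordinate_basis_exists (F : {vspace H}) : exists I, coordinate_basis e F I.
Proof.
have [m0 m0S] := fset0Pn _ S_neq0.
have [le _] := total_order_exists.
have [c cE] := exterior_expansion_exists e_basis le (volume_exterior F).
apply: contrapT => noI; apply: (@volume_neq0 _ _ F).
rewrite cE.2 big1 // => I cI; rewrite [c I](_ : _ = 0) ?scale0r //.
apply/eqP; apply: contrapT => /negP cI0; apply: noI; exists I.
by apply/(coordinate_basis_coef e_basis [` m0S]%fset (volume_exterior F) (@volume_neq0 _ _ F) cE).
Qed.

End WeightPolytopeE.

(** * Faces and vertices of finitely generated convex hulls *)

Section ConvexHull.
Variables (R : realType) (n : nat).
Implicit Types (A C : set 'rV[R]_n) (u v x y z : 'rV[R]_n).

(** Convexity with real parameters in the open unit interval, in the form in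
    which [vertex] uses it. *)
Definition closed_under_segments C := forall y z (s : R),
  C y -> C z -> 0 < s < 1 -> C (s *: y + (1 - s) *: z).

Lemma convex_setE C : @convex_set R 'rV[R]_n C <-> closed_under_segments C.
Proof.
split=> [Cc y z s Cy Cz /andP[s0 s1]|Cc].
- have := Cc y z (Itv01 (ltW s0) (ltW s1)) (mem_set Cy) (mem_set Cz).
  by move/set_mem.
- apply/convex_setW => y z /set_mem Cy /set_mem Cz k k0 k1.
  by apply/mem_set; apply: (Cc y z k%:num) => //; rewrite k0.
Qed.

Lemma convex_hull_sub A : A `<=` convex_hull A.
Proof. exact: sub_gen_smallest. Qed.

Lemma convex_hull_min A C :
  closed_under_segments C -> A `<=` C -> convex_hull A `<=` C.
Proof. by move=> /convex_setE Cc AC; exact: smallest_sub. Qed.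

Lemma convex_hull_segments A : closed_under_segments (convex_hull A).
Proof.
move=> y z s Ay Az s01 C [/convex_setE Cc AC].
have CA : @convex_set R 'rV[R]_n C /\ A `<=` C by split=> //; apply/convex_setE.
exact: Cc (Ay C CA) (Az C CA) s01.
Qed.

(** Removing an extreme point from a convex set leaves a convex set; if x were
    not in A, the hull without x would still contain A. *)
Lemma vertex_convex_hull A : vertex (convex_hull A) `<=` A.
Proof.
move=> x [Ax xext]; apply: contrapT => nAx.
suff /(_ _ Ax) [_ /(_ erefl)] : convex_hull A `<=` [set y | convex_hull A y /\ y <> x] by [].
apply: convex_hull_min => [y z s [Ay yx] [Az zx] s01|y Ay].
  split; first exact: convex_hull_segments.
  by move=> /esym /(xext _ _ _ Ay Az s01)[].
by split; [exact: convex_hull_sub|move=> yx; rewrite yx in Ay].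
Qed.

Lemma pairing_is_linear v : linear (pairing v : 'rV[R]_n -> R^o).
Proof.
move=> a x y; rewrite /pairing scaler_sumr -big_split; apply: eq_bigr => i _.
by rewrite !mxE mulrDr /= mulrCA.
Qed.
HB.instance Definition _ v := GRing.isLinear.Build R 'rV[R]_n R^o *:%R
  (pairing v) (pairing_is_linear v).

Lemma pairingC u v : pairing u v = pairing v u.
Proof. by apply: eq_bigr => i _; rewrite mulrC. Qed.

Lemma pairing_segment v y z s :
  pairing v (s *: y + (1 - s) *: z) = s * pairing v y + (1 - s) * pairing v z.
Proof. by rewrite linearD !linearZ. Qed.

Lemma pairing_ge0 x : 0 <= pairing x x.
Proof. by apply: sumr_ge0 => i _; rewrite -expr2 sqr_ge0. Qed.

Lemma pairing_eq0 x : (pairing x x == 0) = (x == 0).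
Proof.
apply/idP/eqP => [|->]; last by rewrite linear0.
rewrite psumr_eq0 => [/allP x0|i _]; last by rewrite -expr2 sqr_ge0.
apply/rowP => i; rewrite mxE; have := x0 i (mem_index_enum _).
by rewrite -expr2 sqrf_eq0 => /eqP.
Qed.

Definition sqdist x y : R := pairing (x - y) (x - y).

Lemma sqdist_segment x y z s :
  sqdist (s *: y + (1 - s) *: z) x =
  s * sqdist y x + (1 - s) * sqdist z x - s * (1 - s) * sqdist y z.
Proof.
rewrite /sqdist /pairing !mulr_sumr -big_split -sumrB; apply: eq_bigr => i _ /=.
by rewrite !mxE; ring.
Qed.

Lemma sqdist_eq0 x y : (sqdist x y == 0) = (x == y).
Proof. by rewrite pairing_eq0 subr_eq0. Qed.

Lemma segment_max (s a b M : R) : 0 < s < 1 -> a <= M -> b <= M ->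
  s * a + (1 - s) * b = M -> a = M /\ b = M.
Proof.
move=> /andP[s0 s1] aM bM sM.
have ha : 0 <= s * (M - a) by rewrite mulr_ge0 ?subr_ge0 // ltW.
have hb : 0 <= (1 - s) * (M - b) by rewrite mulr_ge0 ?subr_ge0 // ltW.
have /eqP : s * (M - a) + (1 - s) * (M - b) = 0 by rewrite -sM; ring.
rewrite paddr_eq0 // !mulf_eq0 (gt_eqF s0) !subr_eq0 (gt_eqF s1) /=.
by move=> /andP[/eqP <- /eqP <-].
Qed.

Section FinitelyGenerated.
Variables (T : finType) (g : T -> 'rV[R]_n) (B : set T).
Local Notation P := (convex_hull (g @` B)).

Section Face.
Variables (v : 'rV[R]_n) (M : R).
Hypothesis leM : forall i, B i -> pairing v (g i) <= M.

(** The points of the hull at which v reaches M form the hull of the generators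
    at which it does.  It is stated for any convex condition Q on those
    generators, because the set of y with <v, y> < M, or <v, y> = M and Q y, is
    convex. *)
Lemma convex_hull_face (Q : set 'rV[R]_n) :
  closed_under_segments Q ->
  (forall i, B i -> pairing v (g i) = M -> Q (g i)) ->
  forall y, P y -> pairing v y <= M /\ (pairing v y = M -> Q y).
Proof.
move=> Qc BQ; apply: convex_hull_min => [y z s [yM yQ] [zM zQ] /andP[s0 s1]|_ [i Bi <-]].
  have s1' : 0 < 1 - s by rewrite subr_gt0.
  rewrite pairing_segment; split.
    have : s * pairing v y <= s * M by rewrite ler_pM2l.
    have : (1 - s) * pairing v z <= (1 - s) * M by rewrite ler_pM2l.
    by lra.
  move=> sM.
  have [] := segment_max _ yM zM sM; first by rewrite s0.
  by move=> /yQ Qy /zQ Qz; apply: Qc => //; rewrite s0.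
by split; [exact: leM|exact: BQ].
Qed.

(** A segment through g i inside the hull stays on the face, hence in the ball
    about x whose boundary contains g i; balls are strictly convex. *)
Lemma farthest_vertex i x : B i -> pairing v (g i) = M ->
  (forall j, B j -> pairing v (g j) = M -> sqdist (g j) x <= sqdist (g i) x) ->
  vertex P (g i).
Proof.
move=> Bi iM far; split; first by apply: convex_hull_sub; exists i.
move=> y z s Py Pz s01 giE.
have [s0 s1] := andP s01; have s1' : 0 < 1 - s by rewrite subr_gt0.
pose Q := [set y | sqdist y x <= sqdist (g i) x].
have Qc : closed_under_segments Q.
  move=> {Py Pz giE s01} {}y {}z {s0 s1 s1'}s Qy Qz /andP[s0 s1]; rewrite /Q /= sqdist_segment.
  have s1' : 0 < 1 - s by rewrite subr_gt0.
  have : s * sqdist y x <= s * sqdist (g i) x by rewrite ler_pM2l.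
  have : (1 - s) * sqdist z x <= (1 - s) * sqdist (g i) x by rewrite ler_pM2l.
  have : 0 <= s * (1 - s) * sqdist y z by rewrite !mulr_ge0 ?pairing_ge0 // ltW.
  by lra.
have [yM yQ] := convex_hull_face Qc far Py.
have [zM zQ] := convex_hull_face Qc far Pz.
have yz : pairing v y = M /\ pairing v z = M.
  by apply: segment_max s01 yM zM _; rewrite -pairing_segment -giE.
have := yQ yz.1; have := zQ yz.2; rewrite /Q /= => Qz Qy.
(* The defect term of [sqdist_segment] must vanish. *)
have yz0 : sqdist y z <= 0.
  rewrite -(pmulr_rle0 _ (mulr_gt0 s0 s1')).
  have := sqdist_segment x y z s; rewrite -giE.
  have : s * sqdist y x <= s * sqdist (g i) x by rewrite ler_pM2l.
  have : (1 - s) * sqdist z x <= (1 - s) * sqdist (g i) x by rewrite ler_pM2l.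
  by lra.
have /eqP : sqdist y z = 0 by apply/eqP; rewrite eq_le yz0 pairing_ge0.
by rewrite sqdist_eq0 => /eqP yz'; rewrite giE -yz' -scalerDl addrC subrK scale1r.
Qed.

End Face.

(** Start from a maximizing generator, pass to the generator of the face that is
    farthest from it, then to the one farthest from that.  If the last step
    comes back to the same point, the face is a point. *)
Lemma vertices_of_face v : B !=set0 -> ~ unique_maximizer v P ->
  exists x y, [/\ vertex P x, vertex P y, x != y & pairing v x = pairing v y].
Proof.
move=> [i0 Bi0] nuniq.
have [i1 Bi1 i1max] : exists2 i, B i & forall j, B j -> pairing v (g j) <= pairing v (g i).
  case: (@Order.TotalTheory.arg_maxP _ _ _ i0 (fun i => `[< B i >]) (fun i => pairing v (g i))).
    exact/asboolP.
  by move=> i /asboolP Bi imax; exists i => // j /asboolP; exact: imax.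
set M := pairing v (g i1) in i1max.
have far x : exists i, [/\ B i, pairing v (g i) = M &
    forall j, B j -> pairing v (g j) = M -> sqdist (g j) x <= sqdist (g i) x].
  case: (@Order.TotalTheory.arg_maxP _ _ _ i1 (fun i => `[< B i /\ pairing v (g i) = M >])
     (fun i => sqdist (g i) x)); first exact/asboolP.
  move=> i /asboolP[Bi iM] imax; exists i; split=> // j Bj jM.
  by apply: imax; apply/asboolP.
have [i [Bi iM ifar]] := far (g i1).
have [j [Bj jM jfar]] := far (g i).
exists (g i), (g j).
split; [exact: farthest_vertex ifar|exact: farthest_vertex jfar| |by rewrite iM jM].
apply/negP => /eqP gij; apply: nuniq.
have face : forall y, P y -> pairing v y <= M /\ (pairing v y = M -> y = g i).
  apply: (convex_hull_face i1max (Q := [set g i])) => [y z s -> -> _|k Bk kM].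
    by rewrite /= -scalerDl addrC subrK scale1r.
  apply/eqP; rewrite -sqdist_eq0 eq_le pairing_ge0 andbT.
  by have := jfar k Bk kM; rewrite -gij /sqdist subrr linear0.
exists (g i); split.
  split; first by apply: convex_hull_sub; exists i.
  by move=> y /face[]; rewrite iM.
move=> y [Py ymax]; have [yM yi] := face _ Py; apply/esym/yi/eqP.
rewrite eq_le yM -iM ymax //; by apply: convex_hull_sub; exists i.
Qed.

End FinitelyGenerated.

(** The kernel of a linear form that is nonzero, since it is positive at d. *)
Lemma perp_hyperplane (d : 'rV[R]_n) : d != 0 -> linear_hyperplane (perp d).
Proof.
move=> dn0; pose f : 'Hom('rV[R]_n, R^o) := linfun (pairing d).
exists (lker f); last first.
  apply/seteqP; split=> v /=; rewrite memv_ker lfunE /= pairingC.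
    by move=> ->.
  by move/eqP.
have dimV : \dim {:'rV[R]_n} = n by rewrite dimvf dim_matrix mul1r.
have := limg_ker_dim f fullv; rewrite capfv dimV => dimE.
suff rank1 : \dim (limg f) = 1%N by rewrite -[RHS]dimE rank1 addn1.
apply/eqP; rewrite eqn_leq; apply/andP; split.
  by apply: leq_trans (dimvS (subvf _)) _; rewrite dimvf.
rewrite lt0n dimv_eq0; apply/negP => /eqP f0.
have : f d \in limg f by rewrite memv_img ?memvf.
by rewrite f0 memv0 lfunE /= pairing_eq0 (negbTE dn0).
Qed.

End ConvexHull.

(** * Reduced echelon frames and bases of maximal weight *)

Section Echelon.
Variables (K : fieldType) (H : vectType K) (S : finType) (e : S -> H).
Hypothesis e_basis : basis_of fullv (codom e).
Local Notation x_ := (coordform e).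
Implicit Types (F G : {vspace H}) (I J : {set S}).

Definition echelon_form F I (f : S -> H) : Prop :=
  forall i, i \in I ->
    f i \in F /\ forall k, k \in I -> x_ k (f i) = (i == k)%:R.

Lemma echelon_form_expand F I f g : coordinate_basis e F I ->
  echelon_form F I f -> g \in F -> g = \sum_(k in I) x_ k g *: f k.
Proof.
move=> [_ inj] fE gF; apply/eqP; rewrite -subr_eq0; apply/eqP; apply: inj.
  by rewrite rpredB // rpred_sum // => k /fE[fF _]; rewrite memvZ.
move=> m mI; rewrite linearB linear_sum (bigD1 m) //= coordformZ (fE m mI).2 // eqxx mulr1.
rewrite big1 ?addr0 ?subrr // => k /andP[kI /negbTE km].
by rewrite coordformZ (fE k kI).2 // km mulr0.
Qed.

(** The projection of F to the span of the e_k, k in I, is injective by the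
    definition of a coordinate basis, hence onto for reasons of dimension; f i
    is the preimage of e i. *)
Lemma echelon_form_exists F I : coordinate_basis e F I ->
  exists f, echelon_form F I f.
Proof.
move=> [cI inj].
pose p (h : H) := \sum_(k in I) x_ k h *: e k.
have p_lin : linear p.
  move=> a h h'; rewrite /p scaler_sumr -big_split; apply: eq_bigr => k _.
  by rewrite linearP scalerDl scalerA.
pose pL := GRing.isLinear.Build K H H *:%R p p_lin.
pose P : 'End(H) := linfun (HB.pack_for {linear H -> H} p pL).
have PE h : P h = p h by rewrite lfunE.
have xP k h : k \in I -> x_ k (P h) = x_ k h.
  by move=> kI; rewrite PE coordform_sum // kI.
have PF0 : (F :&: lker P)%VS = 0%VS.
  apply/eqP; rewrite -subv0; apply/subvP => h; rewrite memv_cap memv_ker memv0.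
  move=> /andP[hF /eqP Ph0]; apply/eqP/inj => // k kI.
  by rewrite -xP // Ph0 linear0.
have PF_span : (P @: F)%VS = <<[seq e m | m in I]>>%VS.
  apply/eqP; rewrite eqEdim; apply/andP; split.
    apply/subvP => _ /memv_imgP[h _ ->]; rewrite PE rpred_sum // => k kI.
    by rewrite memvZ // memv_span // fintype.image_f.
  by rewrite limg_dim_eq // -cI (leq_trans (dim_span _)) // size_image.
have fP i : exists h, i \in I -> h \in F /\ forall k, k \in I -> x_ k h = (i == k)%:R.
  have [iI|//] := boolP (i \in I); last by exists 0.
  have : e i \in (P @: F)%VS by rewrite PF_span memv_span // fintype.image_f.
  move=> /memv_imgP[h hF eih]; exists h => _; split=> // k kI.
  by rewrite -xP // -eih coordform_basis.
by have [f fE] := choice fP; exists f.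
Qed.

(** A vector of F vanishing on I minus i is a multiple of f i, and f i does not
    vanish at m. *)
Lemma coordinate_basis_exchange F I f i m : coordinate_basis e F I ->
  echelon_form F I f -> i \in I -> m \notin I -> x_ m (f i) != 0 ->
  coordinate_basis e F (m |: I :\ i).
Proof.
move=> FI fE iI mI xm; split.
  by rewrite cardsU1 !inE (negbTE mI) andbF -FI.1 (cardsD1 i I) iI.
move=> g gF gJ.
have gE : g = x_ i g *: f i.
  rewrite [LHS](echelon_form_expand FI fE gF) (bigD1 i) //= big1 ?addr0 // => k /andP[kI ki].
  by rewrite gJ ?scale0r // !inE ki kI orbT.
have := gJ m; rewrite !inE eqxx => /(_ isT) /eqP; rewrite gE coordformZ.
rewrite mulf_eq0 (negbTE xm) orbF => /eqP ->.
by rewrite scale0r.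
Qed.

End Echelon.

Section DominantEchelon.
Variables (K : fieldType) (H : vectType K) (S : finType) (e : S -> H).
Hypothesis e_basis : basis_of fullv (codom e).
Variables (R : realDomainType) (w : S -> R).
Local Notation x_ := (coordform e).
Implicit Types (F G : {vspace H}) (I J : {set S}).

(** Each frame vector has its leading term, for the weight w, at its own
    index. *)
Definition dominant_echelon F I (f : S -> H) : Prop :=
  [/\ coordinate_basis e F I, echelon_form e F I f &
      forall i m, i \in I -> m \notin I -> x_ m (f i) != 0 -> w m < w i].

(** Let i be in J but not in I.  Expanding g i in the frame f, its coordinate 1
    at i has to come from some f k with k in I, so w i < w k; but g i then has a
    nonzero coordinate at k, so w k < w i. *)
Lemma dominant_echelon_nested F G I J f g : dominant_echelon F I f ->
  dominant_echelon G J g -> (G <= F)%VS -> J \subset I.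
Proof.
move=> [FI fE fw] [GJ gE gw] GF; apply/fintype.subsetP => i iJ; apply: contrapT => /negP iI.
have [giG giE] := gE i iJ.
have /(congr1 (x_ i)) := echelon_form_expand FI fE (subvP GF _ giG).
rewrite giE // eqxx linear_sum => one.
have [k /and3P[kI gk fk]] : exists k, [&& k \in I, x_ k (g i) != 0 & x_ i (f k) != 0].
  apply/existsP; apply: contrapT => /negP; rewrite negb_exists => /forallP nk.
  move/eqP: one; rewrite big1 ?oner_eq0 // => k kI.
  have := nk k; rewrite kI /= negb_and !negbK coordformZ.
  by case/orP => /eqP ->; rewrite ?mul0r ?mulr0.
have wik := fw k i kI iI fk.
have kJ : k \notin J.
  apply/negP => kJ; move: gk; rewrite giE //; case: (i =P k) => [ik|_]; last by rewrite eqxx.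
  by rewrite ik kI in iI.
by have := lt_trans wik (gw i k iJ kJ gk); rewrite ltxx.
Qed.

Section DiagonalAction.
Variables (F : {vspace H}) (I : {set S}) (f : S -> H).
Variables (D : 'End(H)) (d : S -> K).
Hypotheses (DE : forall m, D (e m) = d m *: e m) (d_neq0 : forall m, d m != 0).

Lemma coordform_diag m h : x_ m (D h) = d m * x_ m h.
Proof.
rewrite {1}(coordform_expand e_basis h) linear_sum.
under eq_bigr do rewrite linearZ /= DE scalerA mulrC.
by rewrite (coordform_sum e_basis (fun k => d k * x_ k h) predT).
Qed.

Lemma diag_lker : lker D = 0%VS.
Proof.
apply/eqP; rewrite -subv0; apply/subvP => h; rewrite memv_ker memv0 => /eqP Dh.
apply/eqP/(coordform_inj e_basis) => m; rewrite linear0.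
have /eqP : d m * x_ m h = 0 by rewrite -coordform_diag Dh linear0.
by rewrite mulf_eq0 (negbTE (d_neq0 m)) => /eqP.
Qed.

Lemma dim_diag_img : \dim (D @: F) = \dim F.
Proof. by rewrite limg_dim_eq // diag_lker capv0. Qed.

Hypothesis FI : coordinate_basis e F I.
Hypothesis fE : echelon_form e F I f.

(** The multiple of D (f i) whose i-th coordinate is 1 again. *)
Definition rescaled_echelon i : H := (d i)^-1 *: D (f i).

Lemma rescaled_echelon_form : echelon_form e (D @: F) I rescaled_echelon.
Proof.
move=> i iI; have [fiF fiE] := fE iI; split; first by rewrite memvZ // memv_img.
move=> k kI; rewrite coordformZ coordform_diag fiE //.
by case: eqP => [->|_]; [rewrite mulr1 mulVf|rewrite !mulr0].
Qed.

Lemma coordinate_basis_diag : coordinate_basis e (D @: F) I.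
Proof.
split; first by rewrite dim_diag_img FI.1.
move=> _ /memv_imgP[h hF ->] h0; rewrite [h]FI.2 ?linear0 // => m mI.
have /eqP := h0 m mI; rewrite coordform_diag mulf_eq0 (negbTE (d_neq0 m)).
by move/eqP.
Qed.

Lemma coordform_rescaled m i :
  x_ m (rescaled_echelon i) = (d i)^-1 * (d m * x_ m (f i)).
Proof. by rewrite coordformZ coordform_diag. Qed.

End DiagonalAction.
End DominantEchelon.

Section MaximalWeight.
Variables (R : realType) (n : nat) (S : {fset 'rV[int]_n}).
Variables (H : vectType R[i]) (e : S -> H).
Hypothesis e_basis : basis_of fullv (codom e).
Hypothesis S_neq0 : S != fset0.

Definition weight (v : 'rV[R]_n) (m : S) : R := pairing v (map_mx intr (val m)).

Lemma weight_inj (m m' : S) :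
  map_mx intr (val m) = map_mx intr (val m') :> 'rV[R]_n -> m = m'.
Proof.
move=> /rowP mm; apply/val_inj/rowP => i.
by have := mm i; rewrite !mxE; apply: intr_inj.
Qed.

(** Take I of maximal weight.  A nonzero coordinate of f i at m outside I allows
    the exchange of i for m, which changes the weight sum by m - i; if the
    weights of i and m were equal, both weight sums would maximize v, and
    uniqueness would give m = i. *)
Lemma dominant_echelon_exists (v : 'rV[R]_n) (F : {vspace H}) :
  (F != 0%VS -> unique_maximizer v (weight_polytope e F)) ->
  exists I f, dominant_echelon e (weight v) F I f.
Proof.
have [F0 _|Fn0 /(_ isT)] := eqVneq F 0%VS.
  have [I FI] := coordinate_basis_exists e_basis S_neq0 F.
  have I0 : I = finset.set0 by apply/eqP; rewrite -cards_eq0 FI.1 F0 dimv0.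
  exists I, (fun=> 0); split=> //; first by move=> i; rewrite I0 inE.
  by move=> i m; rewrite I0 inE.
rewrite weight_polytopeE // => -[x [[_ _] xuniq]].
set P := convex_hull _ in xuniq.
have [I0 FI0] := coordinate_basis_exists e_basis S_neq0 F.
have [I FI Imax] : exists2 I, coordinate_basis e F I & forall J, coordinate_basis e F J ->
    pairing v (weight_sum R J) <= pairing v (weight_sum R I).
  case: (@Order.TotalTheory.arg_maxP _ _ _ I0 (fun I => `[< coordinate_basis e F I >])
     (fun I => pairing v (weight_sum R I))); first exact/asboolP.
  by move=> I /asboolP FI Imax; exists I => // J /asboolP; exact: Imax.
(* A basis with the same weight as I maximizes v on the whole hull. *)
have weight_sum_uniq J : coordinate_basis e F J ->
    pairing v (weight_sum R J) = pairing v (weight_sum R I) -> x = weight_sum R J.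
  move=> FJ JI; apply: xuniq; split; first by apply: convex_hull_sub; exists J.
  move=> y Py; rewrite JI.
  by have [] := @convex_hull_face R n _ (@weight_sum R n S) (coordinate_basis e F) v _ Imax setT
    (fun _ _ _ _ _ _ => Logic.I) (fun _ _ _ => Logic.I) y Py.
have [f fE] := echelon_form_exists e_basis FI.
exists I, f; split=> // i m iI mI fim.
have FJ := coordinate_basis_exchange FI fE iI mI fim.
have sumJ : weight_sum R (m |: I :\ i) =
    weight_sum R I + (map_mx intr (val m) - map_mx intr (val i)).
  rewrite /weight_sum big_setU1 ?inE ?(negbTE mI) ?andbF //= (big_setD1 i iI) /=.
  by rewrite (addrC (map_mx _ (val i))) -addrA (addrC (map_mx _ (val i))) subrK addrC.
have := Imax _ FJ; rewrite sumJ linearD linearB -/(weight v m) -/(weight v i).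
rewrite gerDl subr_le0 le_eqVlt => /orP[/eqP wE|//]; exfalso.
have := weight_sum_uniq _ FJ; rewrite sumJ linearD linearB -/(weight v m) -/(weight v i) wE.
rewrite subrr addr0 => /(_ erefl); rewrite (weight_sum_uniq _ FI erefl) => /eqP.
rewrite addrC -subr_eq subrr eq_sym subr_eq0 => /eqP/weight_inj mi.
by rewrite mi iI in mI.
Qed.

End MaximalWeight.

(** * Orthogonal projections in a finite-dimensional Hilbert space *)

Section HilbertNorm.
Variables (R : realType) (H : vectType R[i]).
Variable dot : {dot H for @Num.conj R[i]}.
Local Notation hn := (hnorm dot).
Implicit Types (x y : H) (V W : {vspace H}).

Definition modulus (a : R[i]) : R := complex.Re `|a|.

Lemma ge0_RRe (a : R[i]) : 0 <= a -> a = (complex.Re a)%:C.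
Proof. by case: a => a b; rewrite lecE /= => /andP[/eqP -> _]. Qed.

Lemma modulusE a : (modulus a)%:C = `|a|.
Proof. by rewrite [RHS](ge0_RRe (normr_ge0 a)). Qed.

Lemma modulus_ge0 a : 0 <= modulus a.
Proof. rewrite -lecR modulusE; exact: normr_ge0. Qed.

Lemma modulus0 : modulus 0 = 0.
Proof. by rewrite /modulus normr0. Qed.

Lemma hnorm_ge0 x : 0 <= hn x.
Proof. exact: sqrtr_ge0. Qed.

Lemma hnorm_sqr x : (hn x ^+ 2)%:C = dot x x.
Proof.
have dotE := ge0_RRe (dnorm_ge0 dot x).
rewrite [RHS]dotE sqr_sqrtr // -lecR -dotE; exact: dnorm_ge0.
Qed.

Lemma hnormE x : (hn x)%:C = sqrtC (dot x x).
Proof. by rewrite -hnorm_sqr rmorphXn /= sqrCK //; rewrite lecR hnorm_ge0. Qed.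

Lemma hnorm0 : hn 0 = 0.
Proof. by rewrite /hnorm linear0l /= sqrtr0. Qed.

Lemma hnormZ a x : hn (a *: x) = modulus a * hn x.
Proof.
apply/eqP; rewrite -(eqrXn2 (n := 2)) ?mulr_ge0 ?hnorm_ge0 ?modulus_ge0 //; apply/eqP.
apply: (fmorph_inj (real_complex R)).
by rewrite /= hnorm_sqr dnormZ -hnorm_sqr -modulusE -rmorphXn -rmorphM exprMn.
Qed.

Lemma hnormN x : hn (- x) = hn x.
Proof. by rewrite /hnorm linearNl linearNr opprK. Qed.

Lemma hnormBC x y : hn (x - y) = hn (y - x).
Proof. by rewrite -hnormN opprB. Qed.

Lemma hnormD_le x y : hn (x + y) <= hn x + hn y.
Proof. by rewrite -lecR rmorphD /= !hnormE; apply: (triangle_lerif dot x y). Qed.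

Lemma hnorm_sum_le (J : finType) (A : pred J) (F : J -> H) :
  hn (\sum_(j | A j) F j) <= \sum_(j | A j) hn (F j).
Proof.
elim/big_ind2 : _ => // [|x a y b xa yb]; first by rewrite hnorm0.
by apply: le_trans (hnormD_le _ _) _; exact: lerD.
Qed.

Lemma modulus_dot_le x y : modulus (dot x y) <= hn x * hn y.
Proof. by rewrite -lecR modulusE rmorphM /= !hnormE; apply: (CauchySchwarz_sqrt dot x y). Qed.

Lemma hnorm_pythagoras x y : dot x y = 0 -> hn (x + y) ^+ 2 = hn x ^+ 2 + hn y ^+ 2.
Proof.
move=> xy0; apply: (fmorph_inj (real_complex R)); rewrite rmorphD /= !hnorm_sqr.
by rewrite dnormD xy0 conjC0 !addr0.
Qed.

Section Projection.
Variable V : {vspace H}.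
Local Notation P := (orthproj dot V).

Lemma orthv_cap : (V :&: orthov dot V)%VS = 0%VS.
Proof.
apply/eqP; rewrite -subv0; apply/subvP => x; rewrite memv_cap memv0.
by move=> /andP[xV /mem_orthovP/(_ _ xV)/eqP]; rewrite dnorm_eq0.
Qed.

Lemma orthv_add : (V + orthov dot V)%VS = fullv.
Proof.
apply/eqP; rewrite eqEsubv subvf /=; apply/subvP => x _.
have [y yV [z [-> _ zV]]] := orthogonal_split dot (vbasis V) x.
rewrite memv_add //; first by rewrite (span_basis (vbasisP V)) in yV.
apply/mem_orthovP => u uV; apply: (span_orthogonal zV); first by rewrite memv_span1.
by rewrite (span_basis (vbasisP V)).
Qed.

Lemma orthproj_mem x : P x \in V.
Proof. exact: memv_pi. Qed.

Lemma orthproj_orth x y : y \in V -> dot (x - P x) y = 0.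
Proof.
move=> yV; have : x \in (V + orthov dot V)%VS by rewrite orthv_add memvf.
move=> /(daddv_pi_add orthv_cap); rewrite -/(orthproj dot V) => xE.
rewrite -{1}xE addrC addKr.
by have /mem_orthovP := memv_pi (orthov dot V) V x; apply.
Qed.

Lemma orthproj_orthC x y : y \in V -> dot y (x - P x) = 0.
Proof. by move=> yV; apply/eqP; rewrite herm_eq0C; apply/eqP/orthproj_orth. Qed.

Lemma orthproj_id x : x \in V -> P x = x.
Proof. exact: daddv_pi_id orthv_cap. Qed.

Lemma orthproj_eq0 x : (forall y, y \in V -> dot x y = 0) -> P x = 0.
Proof.
move=> xV; apply/eqP; rewrite -(dnorm_eq0 dot).
have := orthproj_orth x (orthproj_mem x).
by rewrite linearBl /= xV ?orthproj_mem // sub0r => /eqP; rewrite oppr_eq0.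
Qed.

Lemma hnorm_orthproj_sqr x : hn x ^+ 2 = hn (P x) ^+ 2 + hn (x - P x) ^+ 2.
Proof.
rewrite -hnorm_pythagoras ?orthproj_orthC ?orthproj_mem //.
by rewrite addrC subrK.
Qed.

Lemma hnorm_orthproj_le x : hn (P x) <= hn x.
Proof.
rewrite -(ler_pXn2r (n := 2)) ?nnegrE ?hnorm_ge0 //.
by rewrite (hnorm_orthproj_sqr x) lerDl sqr_ge0.
Qed.

Lemma hnorm_orthproj_compl_le x : hn (x - P x) <= hn x.
Proof.
rewrite -(ler_pXn2r (n := 2)) ?nnegrE ?hnorm_ge0 //.
by rewrite (hnorm_orthproj_sqr x) lerDr sqr_ge0.
Qed.

End Projection.

(** Write P - Q = (1 - Q) P - Q (1 - P).  The first term is small because V is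
    close to W.  For the second, let z be orthogonal to V and y = Q z; then
    <y, y> = <y, z> = <y - x, z> for every x in V, and x can be chosen close
    to y. *)
Lemma orthproj_dist V W (delta : R) : 0 <= delta ->
  (forall x, x \in V -> exists2 y, y \in W & hn (x - y) <= delta * hn x) ->
  (forall y, y \in W -> exists2 x, x \in V & hn (y - x) <= delta * hn y) ->
  forall x, hn (orthproj dot V x - orthproj dot W x) <= 2 * delta * hn x.
Proof.
move=> delta0 VW WV x; set P := orthproj dot V; set Q := orthproj dot W.
have PQ : P x - Q x = (P x - Q (P x)) - Q (x - P x).
  by rewrite [Q (x - P x)]linearB opprB addrA subrK.
have near1 : hn (P x - Q (P x)) <= delta * hn x.
  have [y yW] := VW _ (orthproj_mem V x); move=> yle.
  have -> : P x - Q (P x) = (P x - y) - Q (P x - y).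
    by rewrite linearB /= [Q y]orthproj_id // opprB addrA subrK.
  apply: le_trans (hnorm_orthproj_compl_le _ _) _; apply: le_trans yle _.
  by rewrite ler_wpM2l // hnorm_orthproj_le.
have near2 : hn (Q (x - P x)) <= delta * hn x.
  set z := x - P x; set y := Q z.
  have [x' x'V x'le] := WV _ (orthproj_mem W z).
  have yz : dot y y = dot (y - x') z.
    rewrite linearBl /= [dot x' z]orthproj_orthC // subr0.
    apply/eqP; rewrite eq_sym -subr_eq0 -linearBr /=.
    by rewrite orthproj_orthC ?orthproj_mem.
  have yy : hn y ^+ 2 <= delta * hn y * hn z.
    apply: le_trans (_ : hn (y - x') * hn z <= _); last by rewrite ler_wpM2r ?hnorm_ge0.
    apply: le_trans (modulus_dot_le _ _); rewrite -yz -hnorm_sqr.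
    by rewrite -lecR modulusE ger0_norm // lecR sqr_ge0.
  have yz' : hn y <= delta * hn z.
    have [->|y0] := eqVneq (hn y) 0; first by rewrite mulr_ge0 ?hnorm_ge0.
    have y_gt0 : 0 < hn y by rewrite lt_def y0 hnorm_ge0.
    by rewrite -(ler_pM2l y_gt0) -expr2 (le_trans yy) // mulrCA mulrA.
  by apply: le_trans yz' _; rewrite ler_wpM2l // hnorm_orthproj_compl_le.
rewrite PQ; apply: le_trans (hnormD_le _ _) _; rewrite hnormN.
by lra.
Qed.

(** A pointwise bound proportional to the norm controls the supremum that
    defines the operator norm. *)
Lemma opnorm_cvg_bound (A : R -> 'End(H)) (B : 'End(H)) (delta : R -> R) :
  (forall t, 0 <= delta t) -> delta t @[t --> +oo] --> (0 : R) ->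
  (forall t x, hn (A t x - B x) <= delta t * hn x) -> opnorm_cvg dot A B.
Proof.
move=> delta0 delta_cvg AB; rewrite /opnorm_cvg.
apply: (@squeeze_cvgr _ _ _ _ (fun=> 0) delta); [|exact: cvg_cst|exact: delta_cvg].
apply: nearW => t; set E := [set hn ((A t - B) x) | x in [set x | hn x <= 1]].
have E0 : E 0 by exists 0; rewrite /= ?linear0 hnorm0.
have Edelta : ubound E (delta t).
  move=> _ [x /= x1 <-]; rewrite lfunE /= opp_lfunE; apply: le_trans (AB t x) _.
  by rewrite ler_piMr.
apply/andP; split; last by apply: ge_sup => //; exists 0.
by apply: sup_upper_bound => //; split; [exists 0|exists (delta t)].
Qed.

End HilbertNorm.

(** * Convergence of subspaces under a diagonal one-parameter group *)

Section EchelonSpan.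
Variables (K : fieldType) (H : vectType K) (S : finType) (e : S -> H).
Hypothesis e_basis : basis_of fullv (codom e).
Local Notation x_ := (coordform e).
Variables (F : {vspace H}) (I : {set S}) (f : S -> H).
Hypothesis fE : echelon_form e F I f.

Lemma echelon_form_free : free [seq f m | m in I].
Proof.
apply/(@freeP _ _ _ (image_tuple f I)) => a a0 j.
have := congr1 (x_ (enum_val j)) a0; rewrite linear0 linear_sum (bigD1 j) //= => aE.
rewrite -aE nth_image coordformZ (fE (enum_valP j)).2 ?enum_valP // eqxx mulr1.
rewrite big1 ?addr0 // => k kj.
rewrite nth_image coordformZ (fE (enum_valP k)).2 ?enum_valP //.
by rewrite (inj_eq enum_val_inj) (negbTE kj) mulr0.
Qed.

Lemma echelon_form_span : coordinate_basis e F I -> <<[seq f m | m in I]>>%VS = F.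
Proof.
move=> FI; apply/eqP; rewrite eqEdim; apply/andP; split.
  by apply/span_subvP => _ /fintype.imageP[m mI ->]; have [] := fE mI.
by have := echelon_form_free; rewrite /free => /eqP ->; rewrite size_image FI.1.
Qed.

Lemma coord_span_echelon : echelon_form e <<[seq e m | m in I]>>%VS I e.
Proof.
move=> i iI; split; first by rewrite memv_span // fintype.image_f.
by move=> k kI; rewrite coordform_basis.
Qed.

End EchelonSpan.

Section CoordinateSpan.
Variables (K : fieldType) (H : vectType K) (S : finType) (e : S -> H).
Hypothesis e_basis : basis_of fullv (codom e).
Variable I : {set S}.
Local Notation W := <<[seq e m | m in I]>>%VS.

(** A vector of the span has no coordinate outside I. *)
Lemma coord_span_basis : coordinate_basis e W I.
Proof.
split.
  have := echelon_form_free (coord_span_echelon e_basis (I := I)).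
  by rewrite /free => /eqP ->; rewrite size_image.
move=> h hW h0; apply: (coordform_inj e_basis) => m; rewrite linear0.
have [/h0 //|mI] := boolP (m \in I).
suff /subvP/(_ h hW) : (W <= lker (coordform e m))%VS by rewrite memv_ker => /eqP.
apply/span_subvP => _ /fintype.imageP[k kI ->]; rewrite memv_ker coordform_basis //.
by case: (k =P m) => [km|_]; rewrite ?eqxx //; rewrite -km kI in mI.
Qed.

End CoordinateSpan.

Section OrthonormalCoordinates.
Variables (R : realType) (H : vectType R[i]) (dot : {dot H for @Num.conj R[i]}).
Variables (S : finType) (e : S -> H).
Hypothesis e_basis : basis_of fullv (codom e).
Hypothesis e_orthonormal : orthonormal dot (codom e).
Local Notation x_ := (coordform e).
Local Notation hn := (hnorm dot).

Lemma basis_inj : injective e.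
Proof. by apply/injectiveP; exact: free_uniq (basis_free e_basis). Qed.

Lemma dot_basis m k : dot (e m) (e k) = (m == k)%:R.
Proof.
have /orthonormalP[_ ->] := e_orthonormal; rewrite ?codom_f //.
by rewrite (inj_eq basis_inj).
Qed.

Lemma coordform_dot m h : x_ m h = dot h (e m).
Proof.
rewrite {2}(coordform_expand e_basis h) linear_sumlz (bigD1 m) //=.
rewrite linearZl_LR /= dot_basis eqxx [X in _ = X + _]mulr1 big1 ?addr0 // => k /negbTE km.
by rewrite linearZl_LR /= dot_basis km [LHS]mulr0.
Qed.

Lemma hnorm_basis m : hn (e m) = 1.
Proof. by rewrite /hnorm dot_basis eqxx /= sqrtr1. Qed.

Lemma modulus_coordform_le m h : modulus (x_ m h) <= hn h.
Proof.
by rewrite coordform_dot (le_trans (modulus_dot_le _ _ _)) // hnorm_basis mulr1.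
Qed.

Lemma hnorm_coordform_le h : hn h <= \sum_m modulus (x_ m h).
Proof.
rewrite {1}(coordform_expand e_basis h) (le_trans (hnorm_sum_le _ _ _)) //.
by apply: ler_sum => m _; rewrite hnormZ hnorm_basis mulr1.
Qed.

Lemma orthproj_coord_span (I : {set S}) m :
  orthproj dot <<[seq e m | m in I]>>%VS (e m) = (m \in I)%:R *: e m.
Proof.
have [mI|mI] := boolP (m \in I).
  by rewrite orthproj_id ?scale1r // memv_span // fintype.image_f.
rewrite scale0r; apply: orthproj_eq0 => y.
have WE := echelon_form_expand (coord_span_basis e_basis I) (coord_span_echelon e_basis (I := I)).
move=> /WE ->; rewrite linear_sumr big1 // => k kI.
rewrite linearZr_LR /= dot_basis; case: eqP => [mk|_]; last by rewrite [LHS]mulr0.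
by rewrite mk kI in mI.
Qed.

(** Both subspaces are parametrized by their coordinates on I, and vectors with
    the same coordinates are close: a coordinate is bounded by the norm, so
    replacing each g k by e k costs at most delta times the norm. *)
Lemma orthproj_echelon_dist F (I : {set S}) g (delta : R) :
  coordinate_basis e F I -> echelon_form e F I g ->
  \sum_(k in I) hn (g k - e k) <= delta ->
  forall x, hn (orthproj dot F x - orthproj dot <<[seq e m | m in I]>>%VS x)
    <= 2 * delta * hn x.
Proof.
move=> FI gE gdelta.
have dist (a : S -> R[i]) h : (forall k, modulus (a k) <= hn h) ->
    hn (\sum_(k in I) a k *: (g k - e k)) <= delta * hn h.
  move=> ah; apply: le_trans (hnorm_sum_le _ _ _) _.
  apply: le_trans (_ : (\sum_(k in I) hn (g k - e k)) * hn h <= _); last first.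
    by rewrite ler_wpM2r ?hnorm_ge0.
  rewrite mulr_suml; apply: ler_sum => k _.
  by rewrite hnormZ mulrC ler_wpM2l ?hnorm_ge0.
have WI := coord_span_basis e_basis I.
have eE := coord_span_echelon e_basis (I := I).
apply: orthproj_dist.
- by apply: le_trans gdelta; apply: sumr_ge0 => k _; exact: hnorm_ge0.
- move=> x xF; exists (\sum_(k in I) x_ k x *: e k).
    by apply: rpred_sum => k kI; rewrite memvZ // (eE k kI).1.
  rewrite {1}(echelon_form_expand FI gE xF) -sumrB.
  under eq_bigr do rewrite -scalerBr.
  by apply: dist => k; exact: modulus_coordform_le.
- move=> y yW; exists (\sum_(k in I) x_ k y *: g k).
    by apply: rpred_sum => k kI; rewrite memvZ // (gE k kI).1.
  rewrite hnormBC {2}(echelon_form_expand WI eE yW) -sumrB.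
  under eq_bigr do rewrite -scalerBr.
  by apply: dist => k; exact: modulus_coordform_le.
Qed.

End OrthonormalCoordinates.

Section ExponentialFlow.
Variables (R : realType) (H : vectType R[i]) (dot : {dot H for @Num.conj R[i]}).
Variables (S : finType) (e : S -> H).
Hypothesis e_basis : basis_of fullv (codom e).
Hypothesis e_orthonormal : orthonormal dot (codom e).
Local Notation x_ := (coordform e).
Local Notation hn := (hnorm dot).
Variables (w : S -> R) (D : R -> 'End(H)).
Definition flow_factor (t : R) (m : S) : R[i] := (expR (t * w m))%:C.
Hypothesis DE : forall t m, D t (e m) = flow_factor t m *: e m.

Lemma flow_factor_neq0 t m : flow_factor t m != 0.
Proof. by rewrite (fmorph_eq0 (real_complex R)) gt_eqF // expR_gt0. Qed.

Lemma expR_decay (a : R) : a < 0 -> expR (t * a) @[t --> +oo] --> (0 : R).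
Proof.
move=> a0; have na0 : 0 < - a by rewrite oppr_gt0.
rewrite (_ : (fun t => expR (t * a)) = (fun x => expR (- x)) \o (fun t => t * - a)); last first.
  by apply/funext => t /=; rewrite mulrN opprK.
apply: (cvg_comp _ _ _ (@cvgr_expR R)); apply: gt0_cvgMly => //; exact: cvg_id.
Qed.

Lemma sum_cvg0 (J : finType) (A : pred J) (u : J -> R -> R) :
  (forall j, A j -> u j t @[t --> +oo] --> (0 : R)) ->
  (\sum_(j | A j) u j t) @[t --> +oo] --> (0 : R).
Proof.
move=> u0; have sum0 : \sum_(j | A j) (0 : R) = 0 by rewrite big1.
rewrite -[X in _ --> X]sum0.
by apply: cvg_big => //; exact: (@add_continuous R^o).
Qed.

Section Subspace.
Variables (F : {vspace H}) (I : {set S}) (f : S -> H).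
Hypothesis FIf : dominant_echelon e w F I f.
Local Notation W := <<[seq e m | m in I]>>%VS.

Definition flow_frame t i := rescaled_echelon f (D t) (flow_factor t) i.

Lemma flow_frame_echelon t : echelon_form e (D t @: F) I (flow_frame t).
Proof.
have [FI fE _] := FIf.
exact: (rescaled_echelon_form e_basis (DE t) (flow_factor_neq0 t) fE).
Qed.

Lemma flow_coordinate_basis t : coordinate_basis e (D t @: F) I.
Proof.
have [FI fE _] := FIf.
exact: (coordinate_basis_diag e_basis (DE t) (flow_factor_neq0 t) FI).
Qed.

Definition frame_defect t : R := \sum_(i in I) hn (flow_frame t i - e i).

Lemma frame_defect_ge0 t : 0 <= frame_defect t.
Proof. by apply: sumr_ge0 => i _; exact: hnorm_ge0. Qed.

(** The m-th coordinate of the difference at index i is that of f i times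
    exp (t (w m - w i)), and the exponent is negative whenever this coordinate
    is not 0. *)
Lemma frame_defect_cvg : frame_defect t @[t --> +oo] --> (0 : R).
Proof.
have [FI fE fw] := FIf.
pose bound t := \sum_(i in I) \sum_(m | m \notin I)
   modulus (x_ m (f i)) * expR (t * (w m - w i)).
have bound_cvg : bound t @[t --> +oo] --> (0 : R).
  apply: sum_cvg0 => i iI.
  apply: sum_cvg0 => m mI.
  have [->|fim] := eqVneq (x_ m (f i)) 0.
    by rewrite modulus0; under eq_fun do rewrite mul0r; exact: cvg_cst.
  rewrite -[X in _ --> X](mulr0 (modulus (x_ m (f i)))).
  by apply: cvgM; [exact: cvg_cst|apply: expR_decay; rewrite subr_lt0 fw].
apply: (@squeeze_cvgr _ _ _ _ (fun=> 0) bound); [|exact: cvg_cst|exact: bound_cvg].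
apply: nearW => t; rewrite frame_defect_ge0 /=; apply: ler_sum => i iI.
apply: le_trans (hnorm_coordform_le e_basis e_orthonormal _) _.
rewrite (bigID (mem I)) /= big1 ?add0r.
  apply: ler_sum => m mI; rewrite linearB /= coordform_basis //.
  case: eqP => [im|_]; first by rewrite -im iI in mI.
  rewrite subr0 (coordform_rescaled e_basis f (DE t)) mulrA mulrC.
  rewrite -lecR modulusE normrM rmorphM /= modulusE ler_wpM2l //.
  rewrite /flow_factor -[X in X * _](fmorphV (real_complex R)) -rmorphM /=.
  rewrite ger0_norm; last by rewrite lecR mulr_ge0 ?invr_ge0 ?expR_ge0.
  by rewrite lecR -expRN mulrC -expRD -mulrBr.
move=> m mI; rewrite linearB /= coordform_basis //.
have [_ ->] := flow_frame_echelon t iI => //.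
by rewrite subrr modulus0.
Qed.

(** The frames converge vector by vector, and the topology of the Grassmannian
    is the quotient of that of the free tuples. *)
Lemma flow_grassmann_cvg :
  grassmann_cvg dot (\dim F) (fun t => D t @: F)%VS W.
Proof.
have [FI fE _] := FIf; split.
- by move=> t; rewrite -(flow_coordinate_basis t).1 -FI.1.
- by rewrite -(coord_span_basis e_basis I).1 FI.1.
move=> O Oopen OW; rewrite -FI.1 in Oopen.
pose frame t := image_tuple (flow_frame t) I.
have [eps eps0 epsO] := Oopen (image_tuple e I)
  (echelon_form_free (coord_span_echelon e_basis (I := I))) OW.
have : \forall t \near +oo, frame_defect t < eps.
  by apply: cvgr_lt frame_defect_cvg _ eps0.
apply: filterS => t teps.
rewrite -(echelon_form_span (flow_frame_echelon t) (flow_coordinate_basis t)).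
apply: (epsO (frame t)); first exact: echelon_form_free (flow_frame_echelon t).
move=> j; rewrite !(tnth_nth 0) /= !nth_image; apply: le_lt_trans teps.
rewrite /frame_defect (bigD1 (enum_val j)) ?enum_valP //= lerDl.
by apply: sumr_ge0 => k _; exact: hnorm_ge0.
Qed.

Lemma flow_orthproj_dist t x :
  hn (orthproj dot (D t @: F)%VS x - orthproj dot W x)
    <= 2 * frame_defect t * hn x.
Proof.
exact: (orthproj_echelon_dist e_basis e_orthonormal (flow_coordinate_basis t)
  (flow_frame_echelon t)).
Qed.

End Subspace.
End ExponentialFlow.

(** * Partial derivatives of Laurent polynomials *)

Section LaurentDerivatives.
Variables (K : numFieldType) (n : nat).
Implicit Types z : 'rV[K]_n.

Lemma is_derive_exprz (x : K^o) (k : int) : x != 0 ->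
  is_derive x (1 : K^o) (fun y : K^o => y ^ k : K^o) (k%:~R * x ^ (k - 1)).
Proof.
move=> x0.
have dX (j : nat) : is_derive x (1 : K^o) (fun y : K^o => y ^+ j : K^o) (j%:R * x ^+ j.-1).
  apply: DeriveDef; first exact: exprn_derivable.
  by rewrite exp_derive /= [LHS]mulr1.
case: k => j.
  apply: is_derive_eq (dX j) _; case: j => [|j]; first by rewrite !mul0r.
  by rewrite (_ : Posz j.+1 - 1 = j) // -addn1 PoszD addrK.
have xj0 : (x : K) ^+ j.+1 != 0 by rewrite expf_neq0.
have [dXj dXE] := dX j.+1.
pose f : K^o -> K := fun y => y ^+ j.+1.
have -> : (fun y : K^o => y ^ Negz j : K^o) = (fun y => (f y)^-1 : K^o) by [].
apply: DeriveDef; first exact: (@derivableV K K^o f x 1 xj0 dXj).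
rewrite (@deriveV K K^o f x 1 xj0 dXj) [X in _ *: X]dXE.
have -> : Negz j - 1 = - Posz j.+2 by rewrite NegzE -opprD -PoszD addn1.
have -> : (Negz j)%:~R = - j.+1%:R :> K by rewrite NegzE mulrNz.
have xj : (x : K) ^+ j != 0 by rewrite expf_neq0.
rewrite -exprnN; change (- ((x : K) ^+ j.+1) ^- 2 * (j.+1%:R * x ^+ j) = - j.+1%:R * x ^- j.+2).
rewrite !exprS; move: (x ^+ j) xj j.+1%:R => y y0 c; field.
by rewrite y0 x0.
Qed.

Lemma monomialD z m m' : torus z ->
  monomial z (m + m') = monomial z m * monomial z m'.
Proof.
move=> z0; rewrite /monomial -big_split; apply: eq_bigr => i _.
by rewrite mxE expfzDr.
Qed.

Lemma monomial_neq0 z m : torus z -> monomial z m != 0.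
Proof. by move=> z0; apply/prodf_neq0 => i _; rewrite expfz_neq0. Qed.

(** On the line through z in the direction i, the monomial is the power of one
    variable times the constant C. *)
Lemma is_derive_monomial z m (i : 'I_n) : torus z ->
  is_derive z (delta_mx 0 i) (fun y : 'rV[K]_n => monomial y m : K^o)
    ((m 0 i)%:~R * monomial z (m - delta_mx 0 i)).
Proof.
move=> z0; pose C := \prod_(j | j != i) z 0 j ^ m 0 j.
have line h : monomial (h *: delta_mx 0 i + z) m = (h *: 1 + z 0 i) ^ m 0 i * C.
  rewrite /monomial (bigD1 i) //= !mxE !eqxx; congr (_ * _).
  by apply: eq_bigr => j /negbTE ji; rewrite !mxE ji andbF mulr0 add0r.
have line0 : monomial z m = z 0 i ^ m 0 i * C by rewrite [LHS](bigD1 i).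
pose q1 (h : K) : K := h^-1 * ((h *: 1 + z 0 i) ^ m 0 i - z 0 i ^ m 0 i).
pose q (h : K) : K := h^-1 * (monomial (h *: delta_mx 0 i + z) m - monomial z m).
have qE : q = (fun h => q1 h * C).
  by apply/funext => h; rewrite /q /q1 line line0 -mulrBl mulrA.
have [dx dE] := is_derive_exprz (m 0 i) (z0 i).
have zm : (z 0 i) ^ (m 0 i - 1) * C = monomial z (m - delta_mx 0 i).
  rewrite [RHS](bigD1 i) //= !mxE !eqxx; congr (_ * _).
  by apply: eq_bigr => j /negbTE ji; rewrite !mxE ji andbF subr0.
have q1_cvg : q1 @ 0^' --> ((m 0 i)%:~R * z 0 i ^ (m 0 i - 1) : K^o).
  by rewrite -dE; exact: dx.
have q_cvg : q @ 0^' --> ((m 0 i)%:~R * monomial z (m - delta_mx 0 i) : K^o).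
  by rewrite qE -zm mulrA; apply: (@cvgM K K _ _ q1 (cst C)) => //; exact: cvg_cst.
apply: DeriveDef; last exact: (cvg_lim _ q_cvg).
by apply/cvg_ex; exists ((m 0 i)%:~R * monomial z (m - delta_mx 0 i)); exact: q_cvg.
Qed.

Lemma torus_nbhs z : torus z -> \forall y \near z, torus y.
Proof.
move=> z0.
apply: (@filter_forall _ 'I_n (fun i (y : 'rV[K]_n) => y 0 i != 0) (nbhs z)) => i.
exact: (@cvgr_neq0 K K^o _ (nbhs z) _ (fun y : 'rV[K]_n => y 0 i : K^o) _
  (@coord_continuous K 1 n 0 i z) (z0 i)).
Qed.

Section LaurentPolynomial.
Variable S : {fset 'rV[int]_n}.
Implicit Types (c : S -> K) (s : seq 'I_n) (sigma : 'rV[int]_n).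

(** The shift sigma of the exponents is kept apart because every partial
    derivative lowers all of them by the same vector; only the coefficients then
    depend on the monomial. *)
Definition laurent c sigma z : K := \sum_m c m * monomial z (val m - sigma).

Definition shift_of s : 'rV[int]_n := \sum_(i <- s) delta_mx 0 i.

(** The product of falling factorials by which the derivatives listed in s
    multiply the coefficient of the monomial m. *)
Fixpoint falling s (m : S) : K :=
  if s is i :: s' then falling s' m * ((val m - shift_of s') 0 i)%:~R else 1.

Lemma derive_laurent c sigma z (i : 'I_n) : torus z ->
  'D_(delta_mx 0 i) (laurent c sigma : 'rV[K]_n -> K^o) z =
  laurent (fun m => c m * ((val m - sigma) 0 i)%:~R) (sigma + delta_mx 0 i) z.
Proof.
move=> z0; rewrite /laurent.
have dm (m : S) := is_derive_monomial (val m - sigma) i z0.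
pose h (j : 'I_#|{: S}|) : 'rV[K]_n -> K^o :=
  c (enum_val j) \*: (fun y => monomial y (val (enum_val j) - sigma) : K^o).
pose dh (j : 'I_#|{: S}|) : K^o := c (enum_val j) *:
  (((val (enum_val j) - sigma) 0 i)%:~R *
   monomial z (val (enum_val j) - sigma - delta_mx 0 i) : K^o).
have dsum : is_derive z (delta_mx 0 i) (\sum_j h j) (\sum_j dh j).
  by apply: is_derive_sum => j; apply: is_deriveZ; exact: dm.
have reidx (E : S -> K) : \sum_m E m = \sum_(j < #|{: S}|) E (enum_val j).
  by rewrite (reindex (@enum_val _ S)) //; exact/onW_bij/enum_val_bij.
have -> : (fun y => \sum_m c m * monomial y (val m - sigma) : K^o) = \sum_j h j.
  by apply/funext => y; rewrite fct_sumE reidx.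
rewrite (@derive_val _ _ _ _ _ _ _ dsum) reidx; apply: eq_bigr => j _.
by rewrite /dh [LHS]mulrA opprD addrA.
Qed.

(** The torus is open, so the values of f outside it do not affect derivatives
    at its points. *)
Lemma partials_laurent c (f : 'rV[K]_n -> K^o) s :
  (forall y, torus y -> f y = laurent c 0 y) ->
  forall z, torus z ->
    partials s f z = laurent (fun m => c m * falling s m) (shift_of s) z.
Proof.
move=> fE; elim: s => [|i s IH] z z0 /=.
  rewrite fE // /laurent /shift_of big_nil.
  by apply: eq_bigr => m _; rewrite mulr1.
have -> : 'D_(delta_mx 0 i) (partials s f) z =
    'D_(delta_mx 0 i) (laurent (fun m => c m * falling s m) (shift_of s) : _ -> K^o) z.
  apply: near_eq_derive; near=> y; apply: IH.
  by near: y; exact: torus_nbhs.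
rewrite derive_laurent // /shift_of big_cons addrC.
by apply: eq_bigr => m _; rewrite mulrA.
Unshelve. all: by end_near. Qed.

(** The common shift of the exponents contributes the factor z^(-shift), which
    is invertible on the torus. *)
Lemma vanishes_laurent c (f : 'rV[K]_n -> K^o) (j : nat) z :
  (forall y, torus y -> f y = laurent c 0 y) -> torus z ->
  vanishes_to_order j f z <->
  forall s, (size s < j)%N -> \sum_m c m * falling s m * monomial z (val m) = 0.
Proof.
move=> fE z0; have partE s : partials s f z =
    monomial z (- shift_of s) * \sum_m c m * falling s m * monomial z (val m).
  rewrite (partials_laurent _ fE) // /laurent mulr_sumr; apply: eq_bigr => m _.
  by rewrite monomialD // mulrCA mulrC mulrAC mulrC mulrA.
split=> fz s sj; last by rewrite partE fz // mulr0.
have /eqP := fz s sj; rewrite partE mulf_eq0 (negbTE (monomial_neq0 _ z0)).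
by move/eqP.
Qed.

End LaurentPolynomial.
End LaurentDerivatives.

(** * The exponential torus, vanishing orders and hyperplanes *)

Section ExponentialTorus.
Variables (R : realType) (n : nat).
Implicit Types (w : 'rV[R]_n) (m : 'rV[int]_n).

Lemma torus_expv w : torus (expv w).
Proof. by move=> i; rewrite mxE (fmorph_eq0 (real_complex R)) gt_eqF // expR_gt0. Qed.

Lemma expRMz (x : R) (k : int) : expR (x * k%:~R) = expR x ^ k.
Proof.
case: k => k; first by rewrite expRM_natr.
by rewrite NegzE mulrNz mulrN expRN expRM_natr -exprnN.
Qed.

Lemma monomial_expv w m :
  monomial (expv w) m = (expR (pairing w (map_mx intr m)))%:C.
Proof.
rewrite /monomial /pairing expR_sum rmorph_prod; apply: eq_bigr => i _.
by rewrite !mxE expRMz (fmorphXz (real_complex R)).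
Qed.

End ExponentialTorus.

Section FunctionSpace.
Variables (R : realType) (n : nat) (S : {fset 'rV[int]_n}).
Variables (H : vectType R[i]) (e : S -> H).
Hypothesis e_basis : basis_of fullv (codom e).
Variables (ev : H -> 'rV[R[i]]_n -> R[i]) (c : S -> R[i]).
Hypothesis ev_linear : forall a f g z, torus z ->
  ev (a *: f + g) z = a * ev f z + ev g z.
Hypothesis ev_basis : forall m z, torus z -> ev (e m) z = c m * monomial z (val m).
Local Notation x_ := (coordform e).

Lemma ev_laurent f z : torus z ->
  ev f z = laurent (fun m => x_ m f * c m) 0 z.
Proof.
move=> z0; rewrite {1}(coordform_expand e_basis f) /laurent.
have ev0 : ev 0 z = 0.
  have := ev_linear 1 0 0 z0; rewrite scaler0 addr0 mul1r => /eqP.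
  by rewrite -subr_eq subrr eq_sym => /eqP.
elim/big_rec2 : _ => // m y h _ <-.
by rewrite ev_linear // ev_basis // subr0 mulrA.
Qed.

(** D multiplies the coefficient of z^m by d m, which is the inverse of p^m, so
    the conditions for D h to vanish at p are those for h to vanish at 1. *)
Lemma vanishing_set_diag (D : 'End(H)) (d : S -> R[i]) (F : {vspace H}) p j :
  (forall m, D (e m) = d m *: e m) -> torus p ->
  (forall m, d m * monomial p (val m) = 1) ->
  [set` F] = vanishing_set ev j (const_mx 1) ->
  vanishing_set ev j p = [set` (D @: F)%VS].
Proof.
move=> DE p0 dp Fvan.
have one0 : torus (const_mx 1 : 'rV[R[i]]_n) by move=> i; rewrite mxE oner_eq0.
have d0 m : d m != 0.
  by apply/negP => /eqP d0; have := dp m; rewrite d0 mul0r => /eqP; rewrite eq_sym oner_eq0.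
have one1 m : monomial (const_mx 1 : 'rV[R[i]]_n) m = 1.
  by rewrite /monomial big1 // => i _; rewrite mxE exp1rz.
have transport h : vanishing_set ev j p (D h) <-> vanishing_set ev j (const_mx 1) h.
  rewrite /vanishing_set /= (vanishes_laurent _ (@ev_laurent (D h)) p0).
  rewrite (vanishes_laurent _ (@ev_laurent h) one0).
  have sumE s : \sum_m x_ m (D h) * c m * falling _ s m * monomial p (val m) =
      \sum_m x_ m h * c m * falling _ s m * monomial (const_mx 1) (val m).
    apply: eq_bigr => m _; rewrite one1 mulr1 (coordform_diag e_basis DE).
    by rewrite -[RHS]mul1r -(dp m); ring.
  by split=> hv s sj; have := hv s sj; rewrite sumE.
have surj f : exists h, f = D h.
  have : f \in limg D.
    suff -> : limg D = fullv by rewrite memvf.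
    apply/eqP; rewrite eqEdim subvf /= limg_dim_eq //.
    by rewrite (diag_lker e_basis DE d0) capv0.
  by move=> /memv_imgP[h _ ->]; exists h.
apply/seteqP; split=> [f|f /= /memv_imgP[h hF ->]].
  have [h ->] := surj f => /transport; rewrite -Fvan => hF.
  exact: memv_img.
by apply/transport; rewrite -Fvan.
Qed.

End FunctionSpace.

Section Hyperplanes.
Variables (R : realType) (n : nat) (S : {fset 'rV[int]_n}).
Variables (H : vectType R[i]) (e : S -> H).
Hypothesis e_basis : basis_of fullv (codom e).
Hypothesis S_neq0 : S != fset0.
Variables (N : nat) (F : 'I_N -> {vspace H}).

Lemma vertex_differences_finite : finite_set (@vertex_differences R n S H e N F).
Proof.
apply: (@sub_finite_set _ _ ((fun p : {set S} * {set S} =>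
  weight_sum R p.1 - weight_sum R p.2) @` setT)); last first.
  by apply: finite_image; exact: finite_finset.
move=> d [_ [j [x [y [_ + + ->]]]]]; rewrite weight_polytopeE //.
by move=> /vertex_convex_hull[I _ <-] /vertex_convex_hull[J _ <-]; exists (I, J).
Qed.

Lemma inadmissible_perp (v : 'rV[R]_n) : ~ admissible e F v ->
  exists2 d, vertex_differences e F d & perp d v.
Proof.
move=> /existsNP[j /not_implyP[Fj0]]; rewrite weight_polytopeE // => nuniq.
have Bj0 : coordinate_basis e (F j) !=set0.
  by have [I FI] := coordinate_basis_exists e_basis S_neq0 (F j); exists I.
have [x [y [xP yP xy vxy]]] := vertices_of_face Bj0 nuniq.
exists (x - y); last by rewrite /perp /= linearB /= vxy subrr.
split; first by rewrite subr_eq0.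
by exists j, x, y; split=> //; rewrite weight_polytopeE.
Qed.

End Hyperplanes.

(** * The limit of the flow on a chain of subspaces *)

(* The chain F^1, ..., F^N is indexed by 'I_N: [F j] stands for F^(j+1). *)
Theorem lemma5p1 (R : realType) (n : nat) (S : {fset 'rV[int]_n})
    (S_neq0 : S != fset0)
    (H : vectType R[i]) (dot : {dot H for @Num.conj R[i]})
    (e : S -> H) (e_basis : basis_of fullv (codom e))
    (e_orthonormal : orthonormal dot (codom e))
    (U : 'rV[R[i]]_n -> 'End(H))
    (U_torus : forall a, torus a -> forall m : S,
       U a (e m) = monomial a (val m) *: e m)
    (N : nat) (F : 'I_N -> {vspace H})
    (F_chain : forall i j : 'I_N, (i <= j)%N -> (F j <= F i)%VS) :
  (* (a) *)
  ((forall (G : {vspace H}) (le : rel S), G != 0%VS -> total_order le ->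
      (exists2 xi : multiform H (\dim G), exterior_power G xi & xi <> 0) /\
      (forall xi : multiform H (\dim G), exterior_power G xi -> xi <> 0 ->
        (exists! c, exterior_expansion e le xi c) /\
        (forall c, exterior_expansion e le xi c ->
           weight_hull c = weight_polytope e G))) /\
   (let hyperplanes := [set perp d | d in vertex_differences e F] in
    [/\ finite_set hyperplanes,
        (forall A, hyperplanes A -> linear_hyperplane A) &
        [set v | ~ admissible e F v] `<=` \bigcup_(A in hyperplanes) A])) /\
  (forall v : 'rV[R]_n, admissible e F v ->
    let D := fun t : R => U (expv (t *: v)) in
    let P := fun (t : R) (j : 'I_N) => orthproj dot (D t @: F j)%VS in
    (* (b) *)
    (exists I : 'I_N -> {set S},
      let coord_span := fun j => <<[seq e m | m in I j]>>%VS in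
      let q := fun m : S => #|[set j | m \in I j]%SET| in
      [/\ (forall j,
             [/\ #|I j| = \dim (F j),
                 grassmann_cvg dot (\dim (F j)) (fun t => D t @: F j)%VS
                   (coord_span j) &
                 opnorm_cvg dot (P^~ j) (orthproj dot (coord_span j))]),
          (forall i j : 'I_N, (i <= j)%N -> I j \subset I i),
          (exists2 Qinf : 'End(H),
             (forall m, Qinf (e m) = (q m)%:R *: e m) &
             opnorm_cvg dot (fun t => \sum_(j < N) P t j) Qinf),
          (forall m, (q m <= N)%N) &
          (\sum_(m : S) q m = \sum_(j < N) \dim (F j))%N]) /\
    (* (c) *)
    (forall (ev : H -> 'rV[R[i]]_n -> R[i]) (c : S -> R[i]),
      function_space ev ->
      (forall m, c m != 0) ->
      (forall m z, torus z -> ev (e m) z = c m * monomial z (val m)) ->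
      (forall j, [set` F j] = vanishing_set ev j.+1 (const_mx 1)) ->
      forall (t : R) (j : 'I_N),
        let p := expv (- (t *: v)) in
        vanishing_set ev j.+1 p = [set` (D t @: F j)%VS] /\
        (forall W : {vspace H}, [set` W] = vanishing_set ev j.+1 p ->
           orthproj dot W = P t j))).
Proof.
split; [split|].
- move=> G le _ le_order; split.
    by exists (volume G); [exact: volume_exterior|exact: volume_neq0].
  move=> xi xiG xin0; split.
    have [c cE] := exterior_expansion_exists e_basis le xiG.
    exists c; split=> // c' c'E; have [m0 m0S] := fset0Pn _ S_neq0.
    exact: (exterior_expansion_unique (F := G) e_basis [` m0S]%fset cE c'E).
  move=> c cE; rewrite weight_polytopeE //.
  by apply/(is_weight_polytopeE e_basis S_neq0); exists le, xi, c; split.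
- split.
  + exact: finite_image (vertex_differences_finite e_basis S_neq0 F).
  + by move=> _ [d [d0 _] <-]; exact: perp_hyperplane.
  + move=> v /(inadmissible_perp e_basis S_neq0)[d dF vd].
    by exists (perp d) => //; exists d.
move=> v v_adm D P; split; last first.
  move=> ev c [ev_linear _] c0 ev_basis Fvan t j p.
  have p_torus : torus p by exact: torus_expv.
  have Dvan : vanishing_set ev j.+1 p = [set` (D t @: F j)%VS].
    apply: (vanishing_set_diag e_basis ev_linear ev_basis
      (d := fun m : S => monomial (expv (t *: v)) (val m))) => //.
      by move=> m; rewrite /D U_torus //; exact: torus_expv.
    move=> m; rewrite !monomial_expv -rmorphM /= -expRD.
    by rewrite [pairing (- _) _]pairingC linearN /= pairingC subrr expR0.
  split=> // W; rewrite Dvan => WE; congr (orthproj dot _).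
  apply/vspaceP => h; apply/idP/idP => hW.
    by have : [set` W] h by []; rewrite WE.
  by have : [set` (D t @: F j)%VS] h by []; rewrite -WE.
have DE t m : D t (e m) = flow_factor (weight v) t m *: e m.
  rewrite /D U_torus; last exact: torus_expv.
  by rewrite monomial_expv pairingC linearZ /= pairingC.
have [I IP] := choice (fun j => dominant_echelon_exists e_basis S_neq0 (v_adm j)).
have [f fP] := choice IP.
exists I => W q.
have cvgP j : opnorm_cvg dot (P^~ j) (orthproj dot (W j)).
  apply: (@opnorm_cvg_bound _ _ _ _ _ (fun t => 2 * frame_defect dot e (weight v) D (I j) (f j) t)).
  - by move=> t; rewrite mulr_ge0 ?frame_defect_ge0.
  - rewrite -[X in _ --> X](mulr0 2); apply: cvgM; first exact: cvg_cst.
    exact: frame_defect_cvg.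
  - by move=> t x; exact: flow_orthproj_dist.
split.
- move=> j; split=> //; first by have [[]] := fP j.
  exact: flow_grassmann_cvg.
- by move=> i j ij; exact: dominant_echelon_nested (fP i) (fP j) (F_chain _ _ ij).
- exists (\sum_(j < N) orthproj dot (W j)).
    move=> m; rewrite sum_lfunE (eq_bigr (fun j => (m \in I j)%:R *: e m)); last first.
      by move=> j _; rewrite orthproj_coord_span.
    rewrite -scaler_suml -natr_sum /q -sum1_card; congr (_%:R *: _).
    by rewrite [RHS]big_mkcond; apply: eq_bigr => j _; rewrite inE; case: (m \in I j).
  apply: (@opnorm_cvg_bound _ _ _ _ _ (fun t =>
    \sum_j 2 * frame_defect dot e (weight v) D (I j) (f j) t)).
  + by move=> t; apply: sumr_ge0 => j _; rewrite mulr_ge0 ?frame_defect_ge0.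
  + apply: sum_cvg0 => j _.
    rewrite -[X in _ --> X](mulr0 2); apply: cvgM; first exact: cvg_cst.
    exact: frame_defect_cvg.
  + move=> t x; rewrite !sum_lfunE -sumrB mulr_suml.
    apply: le_trans (hnorm_sum_le _ _ _) _; apply: ler_sum => j _.
    exact: flow_orthproj_dist.
- by move=> m; rewrite /q -[X in (_ <= X)%N]card_ord max_card.
- rewrite /q; under eq_bigr do rewrite -sum1_card big_mkcond.
  rewrite exchange_big; apply: eq_bigr => j _.
  have [[<- _] _ _] := fP j; rewrite -sum1_card [RHS]big_mkcond.
  by apply: eq_bigr => m _; rewrite inE.
Qed.
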